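(* Let $X$ be a bounded computable metric space, $D\subset X$, and let $T:X\to X$ be a Borel measurable function which is computable on $X\setminus D$. Suppose that $V\subset PM(X)$ is a recursively compact set of Borel probability measures such that $\mu(D)=0$ for every $\mu\in V$. Then every $T$-invariant measure which is isolated in $V$ (in the weak topology) is a computable point of $PM(X)$.
   Context: A set $E\subset\mathbb N$ is r.e. if it is the range of a partial recursive function; sets $(E_n)_n$ are uniformly r.e. if $\{(n,i): i\in E_n\}$ is r.e. A real is computable if some algorithm outputs, for each input $n$, a rational within $2^{-n}$ of it; uniform computability of a family means that one algorithm works with the index as additional input. A computable metric space (CMS) is a triple $(X,d,\mathcal S)$ where $(X,d)$ is a separable complete metric space, $\mathcal S=(s_i)_{i\in\mathbb N}$ is a dense sequence in $X$ (the ideal points), and the reals $d(s_i,s_j)$ are computable uniformly in $i,j$. Fix an effective enumeration $(q_j)$ of the positive rationals and a recursive bijection $\langle\cdot,\cdot\rangle:\mathbb N^2\to\mathbb N$; the ideal balls are the open balls $B_{\langle i,j\rangle}=B(s_i,q_j)$. A set $U\subset X$ is recursively open if $U=\bigcup_{i\in E}B_i$ for some r.e. $E$; sets $U_n$ are recursively open uniformly in $n$ if $U_n=\bigcup_{i\in E_n}B_i$ with $(E_n)$ uniformly r.e. A point $x\in X$ is computable if $\{i: x\in B_i\}$ is r.e. (equivalently, there is a total recursive $\varphi$ with $d(s_{\varphi(n)},x)<2^{-n}$ for all $n$). A set $K\subset X$ is recursively compact if it is compact and there is a partial recursive function which halts on (a code of) a finite tuple $(i_1,\dots,i_p)$ if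 and only if $K\subset B_{i_1}\cup\dots\cup B_{i_p}$. A function $T:X\to Y$ between CMS's is computable on $C\subset X$ if there are sets $U_n\subset X$, recursively open uniformly in $n$, with $T^{-1}(B^Y_n)\cap C=U_n\cap C$ for all $n$, where $B^Y_n$ are the ideal balls of $Y$. For a bounded CMS $X$, $PM(X)$ is the set of Borel probability measures on $X$ with the distance $W_1(\mu_1,\mu_2)=\sup_{f}\left|\int f\,d\mu_1-\int f\,d\mu_2\right|$, the supremum being over 1-Lipschitz functions $f:X\to\mathbb R$; this metric induces the weak topology. $PM(X)$ is a CMS whose ideal points are the finite rational convex combinations of Dirac measures $\delta_s$ at ideal points $s\in\mathcal S$, with a standard effective numbering. A measure is computable if it is a computable point of this CMS. The condition $\mu(D)=0$ means that $D$ is contained in a Borel set of $\mu$-measure $0$. A measure $\mu\in PM(X)$ is $T$-invariant if $\mu(A)=\mu(T^{-1}(A))$ for every Borel $A$. A $T$-invariant measure $\mu\in V$ is isolated in $V$ if it has a neighbourhood $N$ in $PM(X)$ such that $\mu$ is the only $T$-invariant measure in $N\cap V$. *)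

(* Defs.v *)
(* MathComp-Analysis; Stdlib is used only for its Cantor pairing. *)
From Stdlib Require Cantor.
From HB Require Import structures.
From mathcomp Require Import all_boot all_order all_algebra.
From mathcomp Require Import all_classical all_reals all_analysis.
Set Implicit Arguments.
Unset Strict Implicit.
Unset Printing Implicit Defensive.
Import Order.TTheory GRing.Theory Num.Theory.
Import numFieldNormedType.Exports.
Local Open Scope classical_set_scope.
Local Open Scope ring_scope.

(** * Partial recursive functions *)

(* [recfun n]: Kleene's mu-recursive programs with [n] arguments. *)
Inductive recfun : nat -> Type :=
| Zero n : recfun n
| Succ : recfun 1
| Proj n (i : 'I_n) : recfun n
| Comp n k (f : recfun k) (g : 'I_k -> recfun n) : recfun n
| Prec n (f : recfun n) (g : recfun n.+2) : recfun n.+1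
| Mu n (f : recfun n.+1) : recfun n.

(* [computes f v y]: [f] halts on [v] with output [y].  In the recursion case
   the recursion variable is the first argument and [u t] is the value at [t];
   in the minimization case the searched variable is the first argument, and
   [f] must be defined below the value found. *)
Fixpoint computes n (f : recfun n) : n.-tuple nat -> nat -> Prop :=
  match f in recfun n return n.-tuple nat -> nat -> Prop with
  | Zero _ => fun _ y => y = 0%N
  | Succ => fun v y => y = (thead v).+1
  | Proj _ i => fun v y => y = tnth v i
  | Comp _ k f g => fun v y => exists w : k.-tuple nat,
      (forall i, computes (g i) v (tnth w i)) /\ computes f w y
  | Prec _ f g => fun v y => exists u : nat -> nat,
      [/\ computes f (behead_tuple v) (u 0%N),
          forall t, (t < thead v)%N ->
            computes g (cons_tuple t (cons_tuple (u t) (behead_tuple v)))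
              (u t.+1)
        & y = u (thead v)]
  | Mu _ f => fun v y => computes f (cons_tuple y v) 0%N /\
      forall z, (z < y)%N -> exists w, computes f (cons_tuple z v) w.+1
  end.

Definition halts n (f : recfun n) (v : n.-tuple nat) := exists y, computes f v y.

Definition recursively_enumerable (E : set nat) :=
  exists f : recfun 1, E = [set i | exists n, computes f [tuple n] i].

Definition uniformly_re (E : nat -> set nat) :=
  recursively_enumerable
    [set k | let: (n, i) := Cantor.of_nat k in E n i].

(** * Computable metric spaces *)

Section Codings.
Variable R : realType.

(* An effective enumeration of the positive rationals (with repetitions). *)
Definition posrat (j : nat) : R :=
  let: (a, b) := Cantor.of_nat j in a.+1%:R / b.+1%:R.

(* An effective enumeration of all the rationals: [k] codes (a - b) / (c + 1). *)
Definition ratcode (k : nat) : R :=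
  let: (p, c) := Cantor.of_nat k in
  let: (a, b) := Cantor.of_nat p in (a%:R - b%:R) / c.+1%:R.

Definition uniformly_computable2 (x : nat -> nat -> R) :=
  exists phi : recfun 3, forall i j n, exists2 k,
    computes phi [tuple i; j; n] k & `|ratcode k - x i j| <= 2 ^- n.
End Codings.

#[short(type="completeMetricType")]
HB.structure Definition CompleteMetric (R : realType) :=
  {X of Complete X & Metric R X}.

(* The notions below are stated for pseudometric spaces so that they apply
   verbatim to the space [PM X] of measures. *)
Section Effective.
Variables (R : realType) (X : pseudoMetricType R) (s : nat -> X).

Definition ideal_ball (k : nat) : set X :=
  let: (i, j) := Cantor.of_nat k in ball (s i) (posrat R j).

Definition uniformly_recursively_open (U : nat -> set X) :=
  exists2 E : nat -> set nat, uniformly_re E &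
    forall n, U n = \bigcup_(k in E n) ideal_ball k.

Definition computable_point (x : X) :=
  recursively_enumerable [set k | ideal_ball k x].

Definition recursively_compact (K : set X) :=
  compact K /\
  exists f : recfun 1, forall l : seq nat,
    halts f [tuple CodeSeq.code l] <->
    K `<=` \bigcup_(k in [set` l]) ideal_ball k.
End Effective.

Definition computable_metric_space (R : realType) (X : completeMetricType R)
    (s : nat -> X) :=
  dense (range s) /\ uniformly_computable2 (fun i j => mdist (s i) (s j)).

Definition computable_on (R : realType) (X Y : pseudoMetricType R)
    (s : nat -> X) (t : nat -> Y) (C : set X) (T : X -> Y) :=
  exists2 U : nat -> set X, uniformly_recursively_open s U &
    forall n, T @^-1` ideal_ball t n `&` C = U n `&` C.

Definition bounded_space (R : realType) (X : metricType R) :=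
  exists M : R, forall x y : X, mdist x y <= M.

(** * The space of Borel probability measures *)

Notation borel X := (g_sigma_algebraType (@open X)).

Definition PM (R : realType) (X : completeMetricType R) : Type :=
  probability (borel X) R.

(* Equality of Borel measures.  Elements of [PM X] may still differ as functions
   on non-measurable sets, which is why [PM X] is only a pseudometric space. *)
Definition PM_eq (R : realType) (X : completeMetricType R) (mu nu : PM X) :=
  forall A : set (borel X), measurable A -> mu A = nu A.

Definition lipschitz1 (R : realType) (X : metricType R) : set (X -> R) :=
  [set f | forall x y, `|f x - f y| <= mdist x y].

Section Wasserstein.
Variables (R : realType) (X : completeMetricType R).

(* Extended-real valued; it is finite when [X] is bounded. *)
Definition W1 (mu nu : PM X) : \bar R :=
  ereal_sup [set (`|\int[mu]_x f x - \int[nu]_x f x|)%:E | f in @lipschitz1 R X].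

Definition W1_ball (mu : PM X) (e : R) : set (PM X) :=
  [set nu | (W1 mu nu < e%:E)%E].

Let W1_ent : set_system (PM X * PM X) := entourage_ W1_ball.
Let W1_nbhs (mu : PM X) : set_system (PM X) := nbhs_ W1_ent mu.
Let W1_nbhsE : W1_nbhs = nbhs_ W1_ent. Proof. by []. Qed.

Lemma W1_sym mu nu : W1 mu nu = W1 nu mu.
Proof.
by congr ereal_sup; apply/seteqP; split=> _ [f lf <-]; exists f; rewrite // distrC.
Qed.

Lemma W1_triangle mu nu rho : (W1 mu rho <= W1 mu nu + W1 nu rho)%E.
Proof.
apply: ge_ereal_sup => _ [f lf <-].
apply: (@le_trans _ _ ((`|\int[mu]_x f x - \int[nu]_x f x|)%:E
    + (`|\int[nu]_x f x - \int[rho]_x f x|)%:E)%E).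
  by rewrite -EFinD lee_fin ler_distD.
by apply: leeD; apply: ereal_sup_ubound; exists f.
Qed.

Let W1_ball_center mu (e : R) : 0 < e -> W1_ball mu e mu.
Proof.
move=> e0; apply: le_lt_trans (_ : (0 < e%:E)%E); last by rewrite lte_fin.
by apply: ge_ereal_sup => _ [f lf <-]; rewrite subrr normr0.
Qed.

Let W1_ball_sym mu nu (e : R) : W1_ball mu e nu -> W1_ball nu e mu.
Proof. by rewrite /W1_ball/= W1_sym. Qed.

Let W1_ball_triangle mu nu rho e1 e2 :
  W1_ball mu e1 nu -> W1_ball nu e2 rho -> W1_ball mu (e1 + e2) rho.
Proof.
rewrite /W1_ball/= => h1 h2; apply: le_lt_trans (W1_triangle mu nu rho) _.
by rewrite EFinD; apply: lteD.
Qed.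

HB.instance Definition _ := gen_eqMixin (PM X).
HB.instance Definition _ := gen_choiceMixin (PM X).
HB.instance Definition _ := hasNbhs.Build (PM X) W1_nbhs.
HB.instance Definition _ := @Nbhs_isPseudoMetric.Build R (PM X)
  W1_ent W1_nbhsE W1_ball W1_ball_center W1_ball_sym W1_ball_triangle erefl.

End Wasserstein.

(* The ideal points of [PM X].  The number [n = <h, t>] codes the nonempty
   list [h :: CodeSeq.decode t] of natural numbers; an entry [<a, i>] of this
   list stands for the atom [s i] with weight proportional to [a + 1]. *)
Section IdealMeasures.
Variables (R : realType) (X : completeMetricType R) (s : nat -> X) (n : nat).

Definition atoms : seq (nat * nat) :=
  let: (h, t) := Cantor.of_nat n in
  map Cantor.of_nat (h :: CodeSeq.decode t).

Definition atom_weight (k : nat) : nat := (nth (0, 0)%N atoms k).1.+1.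

Definition atom_point (k : nat) : borel X := s (nth (0, 0)%N atoms k).2.

Definition total_weight : nat := \sum_(k < size atoms) atom_weight k.

Definition atom_prob (k : nat) : {nonneg R} :=
  ((atom_weight k)%:R / total_weight%:R)%:nng.

Definition atomic_measure : set (borel X) -> \bar R :=
  msum (fun k => mscale (atom_prob k) (dirac (atom_point k))) (size atoms).

HB.instance Definition _ := Measure.on atomic_measure.

Let atomic_measureT : atomic_measure setT = 1%E.
Proof.
rewrite /atomic_measure /msum /=.
under eq_bigr do rewrite /mscale /= diracT mule1.
rewrite sumEFin -mulr_suml -natr_sum divff // pnatr_eq0 -lt0n /total_weight.
by rewrite /atoms; case: (Cantor.of_nat n) => h t /=; rewrite big_ord_recl.
Qed.

HB.instance Definition _ :=
  Measure_isProbability.Build _ _ _ atomic_measure atomic_measureT.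

Definition ideal_measure : PM X := atomic_measure.
End IdealMeasures.

Section Invariant.
Variables (R : realType) (X : completeMetricType R) (T : X -> X).

Definition invariant_measure (mu : PM X) :=
  forall A : set (borel X), measurable A -> mu A = mu (T @^-1` A).

Definition isolated_invariant (V : set (PM X)) (mu : PM X) :=
  [/\ V mu, invariant_measure mu &
    exists2 N : set (PM X), nbhs mu N &
      forall nu, N nu -> V nu -> invariant_measure nu -> PM_eq nu mu].
End Invariant.

(* Main.v *)
Require Import Defs.
From Stdlib Require Cantor.
From HB Require Import structures.
From mathcomp Require Import all_boot all_order all_algebra finmap.
From mathcomp Require Import all_classical all_reals all_analysis.
From mathcomp Require Import measurable_realfun zify ring lra.
Set Implicit Arguments.
Unset Strict Implicit.
Unset Printing Implicit Defensive.
Local Open Scope classical_set_scope.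

(** Semi-decide [mu \in B_k] by searching for a finite cover of [V] made of
    [B_k] and of ideal balls known not to contain [mu].  Two kinds of balls are
    used.  By compactness, finitely many balls avoiding [mu] cover the part of
    [V] outside a neighbourhood isolating [mu]; being finitely many, they need
    not be computed.  The other balls consist of non-invariant measures: [nu]
    is not invariant iff there are finite unions of ideal balls [W] and [W'],
    at positive distance from each other, with [nu W + nu (T^-1 W') > 1].  As
    [nu D = 0], [T^-1 W'] may be replaced by a recursively open set, hence by
    finitely many of its ideal balls, and a lower bound on [nu] of a finite
    union of balls can be certified from a nearby ideal measure, by comparing
    both measures on a Lipschitz function between two indicators. *)

(** * Total recursive functions *)

Local Open Scope nat_scope.

(** The measure of an open set is only lower semicontinuous in the measure, so a ball around [nu]
    can certify lower bounds on [nu W] but no upper ones. Non-invariance is therefore expressed by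
    two lower bounds whose sum exceeds 1: for disjoint [W] and [W'], invariance would give
    [nu W + nu (T^-1 W') = nu W + nu W' <= 1]. Positive distance is demanded because a strict
    inequality between a computable distance and rational radii can be recognized. A cover found by
    the search proves [mu \in B_k] because [mu] belongs to [V] and, being invariant, lies in none of
    the other balls. Conversely, isolation makes [mu] the only invariant measure that [B_k] has to
    cover. The algorithm depends non-uniformly on [mu] through the finite list of avoiding balls.
    Partial recursive functions being concrete programs, few are written explicitly: beyond
    arithmetic and pairing, the work is done by closure properties of semi-decidable predicates, and
    list destructors are recovered from their graphs. *)

Lemma computes_inj n (f : recfun n) v y y' :
  computes f v y -> computes f v y' -> y = y'.
Proof.
elim: f v y y' => {n} [n||n i|n k f IHf g IHg|n f IHf g IHg|n f IHf] v y y' /=.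
- by move=> -> ->.
- by move=> -> ->.
- by move=> -> ->.
- move=> [w [gw fw]] [w' [gw' fw']].
  have ww' : w = w' by apply: eq_from_tnth => i; apply: (IHg i) (gw i) (gw' i).
  by move: fw'; rewrite -ww'; apply: IHf.
- move=> [u [f0 gS ->]] [u' [f0' gS' ->]].
  suff: forall t, t <= thead v -> u t = u' t by apply.
  elim=> [|t IHt] tv; first exact: IHf f0 f0'.
  have := gS' _ tv; rewrite -IHt 1?ltnW// => gt'; exact: IHg (gS _ tv) gt'.
- move=> [fy ly] [fy' ly'].
  case: (ltngtP y y') => // yy'.
  + by have [w /(IHf _ _ _ fy)] := ly' _ yy'.
  + by have [w /(IHf _ _ _ fy')] := ly _ yy'.
Qed.

Definition total_rec n (F : n.-tuple nat -> nat) :=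
  exists f : recfun n, forall v, computes f v (F v).

Lemma total_ext n (F G : n.-tuple nat -> nat) : F =1 G -> total_rec F -> total_rec G.
Proof. by move=> FG [f Hf]; exists f => v; rewrite -FG. Qed.

Lemma total_proj n (i : 'I_n) : total_rec (fun v => tnth v i).
Proof. by exists (Proj i). Qed.

Lemma total_comp n k (F : k.-tuple nat -> nat) (G : 'I_k -> n.-tuple nat -> nat) :
  total_rec F -> (forall i, total_rec (G i)) ->
    total_rec (fun v => F [tuple G i v | i < k]).
Proof.
move=> [f Hf] /choice[g Hg]; exists (Comp f g) => v /=.
by exists [tuple G i v | i < k]; split=> // i; rewrite tnth_mktuple.
Qed.

Lemma total_prec n (F : n.-tuple nat -> nat) (G : n.+2.-tuple nat -> nat) :
  total_rec F -> total_rec G ->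
  total_rec (fun v : n.+1.-tuple nat =>
    nat_rec (fun=> nat) (F (behead_tuple v))
      (fun t u => G (cons_tuple t (cons_tuple u (behead_tuple v)))) (thead v)).
Proof.
move=> [f Hf] [g Hg]; exists (Prec f g) => v /=.
exists (nat_rec (fun=> nat) (F (behead_tuple v))
      (fun t u => G (cons_tuple t (cons_tuple u (behead_tuple v))))).
by split=> // t _; apply: Hg.
Qed.

Lemma total_mu n (Q : n.+1.-tuple nat -> nat) (F : n.-tuple nat -> nat) :
  total_rec Q -> (forall v, Q (cons_tuple (F v) v) = 0) ->
  (forall v z, z < F v -> Q (cons_tuple z v) != 0) -> total_rec F.
Proof.
move=> [q Hq] Q0 Qn; exists (Mu q) => v /=; split; first by rewrite -(Q0 v).
move=> z /Qn; have := Hq (cons_tuple z v).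
by case: (Q _) => // w; exists w.
Qed.

Definition op1 (H : nat -> nat) := total_rec (fun v : 1.-tuple nat => H (tnth v ord0)).
Definition op2 (H : nat -> nat -> nat) :=
  total_rec (fun v : 2.-tuple nat => H (tnth v ord0) (tnth v (inord 1))).
Definition op3 (H : nat -> nat -> nat -> nat) :=
  total_rec (fun v : 3.-tuple nat =>
    H (tnth v ord0) (tnth v (inord 1)) (tnth v (inord 2))).

Lemma total_op1 n H (G : n.-tuple nat -> nat) :
  op1 H -> total_rec G -> total_rec (fun v => H (G v)).
Proof.
move=> hH hG; have := total_comp hH (fun=> hG).
by apply: total_ext => v; rewrite tnth_mktuple.
Qed.

Lemma total_op2 n H (G1 G2 : n.-tuple nat -> nat) :
  op2 H -> total_rec G1 -> total_rec G2 -> total_rec (fun v => H (G1 v) (G2 v)).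
Proof.
move=> hH h1 h2; pose G (i : 'I_2) := nth G2 [:: G1] i.
have hG i : total_rec (G i) by rewrite /G; case: i => -[|[]].
have := total_comp hH hG.
by apply: total_ext => v; rewrite !tnth_mktuple /G inordK.
Qed.

Lemma total_const n c : total_rec (fun _ : n.-tuple nat => c).
Proof.
elim: c => [|c IHc]; first by exists (Zero n).
by have := total_op1 (H := S) _ IHc; apply; exists Succ.
Qed.

Lemma op2_rec (F : nat -> nat) (G : nat -> nat -> nat -> nat) (H : nat -> nat -> nat) :
  op1 F -> op3 G -> (forall y, H 0 y = F y) ->
  (forall t y, H t.+1 y = G t (H t y) y) -> op2 H.
Proof.
move=> hF hG H0 HS; have := total_prec hF hG.
apply: total_ext => v; rewrite !(tnth_nth 0) inordK//=.
case/tupleP: v => t v; case/tupleP: v => y v /=.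
rewrite theadE; set w := behead_tuple _;
  have {w}-> : w = [tuple of y :: v] by exact: val_inj.
elim: t => [|t IHt] /=; first by rewrite H0.
by rewrite HS -IHt !(tnth_nth 0) !inordK.
Qed.

Lemma op1_rec c (G : nat -> nat -> nat) (H : nat -> nat) :
  op2 G -> H 0 = c -> (forall t, H t.+1 = G t (H t)) -> op1 H.
Proof.
move=> hG H0 HS; pose H' (t y : nat) := H t.
have hH : op2 H'.
  apply: (@op2_rec (fun=> c) (fun t u y => G t u)) => [||y|t y];
    [exact: total_const| |exact: H0|exact: HS].
  by apply: total_op2 => //; apply: total_proj.
exact: (total_op2 hH (total_proj _) (total_proj ord0)).
Qed.

Lemma op1S : op1 S.
Proof. by exists Succ. Qed.

Lemma op2_addn : op2 addn.
Proof.
apply: (@op2_rec id (fun t u y => u.+1)) => //; first exact: total_proj.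
exact: (total_op1 op1S (total_proj _)).
Qed.

Lemma op2_muln : op2 muln.
Proof.
apply: (@op2_rec (fun=> 0) (fun t u y => y + u)) => //; first exact: total_const.
by apply: (total_op2 op2_addn); apply: total_proj.
Qed.

Lemma op1_pred : op1 predn.
Proof. by apply: (@op1_rec 0 (fun t u => t)) => //; apply: total_proj. Qed.

Lemma op2_subn : op2 subn.
Proof.
(* [op2_rec] recurses on the first argument, so the subtrahend has to come first. *)
suff h : op2 (fun t y => y - t).
  exact: (total_op2 h (total_proj _) (total_proj _)).
apply: (@op2_rec id (fun t u y => u.-1));
  [exact: total_proj| |exact: subn0|by move=> t y; exact: subnS].
exact: (total_op1 op1_pred (total_proj _)).
Qed.

Lemma op1_exp2 : op1 (expn 2).
Proof.
apply: (@op1_rec 1 (fun t u => u + u)) => //; last by move=> t; rewrite expnS mul2n addnn.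
by apply: (total_op2 op2_addn); apply: total_proj.
Qed.

(* The triangular numbers underlying [Cantor.to_nat]. *)
Definition tri (n : nat) : nat := nat_rec (fun=> nat) 0 (fun i m => i.+1 + m) n.

Lemma op1_tri : op1 tri.
Proof.
apply: (@op1_rec 0 (fun t u => t.+1 + u)) => //.
by apply: (total_op2 op2_addn); [apply: (total_op1 op1S)|]; apply: total_proj.
Qed.

Lemma Cantor_to_natE x y : Cantor.to_nat (x, y) = y + tri (y + x).
Proof. by []. Qed.

Lemma op2_pair : op2 (fun x y => Cantor.to_nat (x, y)).
Proof.
apply: (total_op2 op2_addn); first exact: total_proj.
apply: (total_op1 op1_tri); apply: (total_op2 op2_addn); exact: total_proj.
Qed.

Lemma tri_mono : {homo tri : m n / m <= n}.
Proof. by apply: homo_leq => // [? ? ? /leq_trans|n]; [apply|rewrite leq_addl]. Qed.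

(** As [n = y + tri (y + x)] is the code of [(x, y)], one has [tri (x + y) <= n < tri (x + y).+1],
    so the diagonal is the least [z] with [n < tri z.+1]. The truncated difference [n.+1 - tri z.+1]
    vanishes exactly under this condition. *)
Lemma op1_diag : op1 (fun n => (Cantor.of_nat n).1 + (Cantor.of_nat n).2).
Proof.
apply: (@total_mu 1 (fun v => (tnth v (inord 1)).+1 - tri (tnth v ord0).+1)).
- apply: (total_op2 op2_subn); first exact: (total_op1 op1S (total_proj _)).
  exact: (total_op1 op1_tri (total_op1 op1S (total_proj _))).
- move=> v; rewrite !(tnth_nth 0) inordK//=; set n := nth _ v 0.
  rewrite -[in n.+1](Cantor.cancel_to_of n).
  case: (Cantor.of_nat n) => x y /=; rewrite -/(tri (y + x)) -/(tri (x + y)).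
  by rewrite [x + y]addnC; apply/eqP;
    rewrite subn_eq0 plusE addSn ltnS leq_add2r leq_addr.
- move=> v z; rewrite !(tnth_nth 0) inordK//= -/(tri z); set n := nth _ v 0.
  rewrite -[in n.+1](Cantor.cancel_to_of n).
  case: (Cantor.of_nat n) => x y /=;
    rewrite -/(tri (y + x)) plusE -lt0n subn_gt0 ltnS => zxy.
  apply: leq_trans (leq_addl _ _); rewrite addnC.
  by move: zxy; rewrite [x + y]addnC => /tri_mono; rewrite /= addnC.
Qed.

Lemma op1_unpair2 : op1 (fun n => (Cantor.of_nat n).2).
Proof.
have := total_op2 op2_subn (total_proj ord0) (total_op1 op1_tri op1_diag).
apply: total_ext => v /=; set n := tnth _ _.
rewrite -[X in X - _](Cantor.cancel_to_of n).
by case: (Cantor.of_nat n) => x y; rewrite Cantor_to_natE addnC [_ + x]addnC addKn.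
Qed.

Lemma op1_unpair1 : op1 (fun n => (Cantor.of_nat n).1).
Proof.
have := total_op2 op2_subn op1_diag op1_unpair2.
by apply: total_ext => v /=; rewrite addnK.
Qed.

(** * Computability over coded types *)

Arguments Cantor.to_nat : simpl never.
Arguments Cantor.of_nat : simpl never.

(* Codes are bijective, so that a search over [nat] is a search over [A]. *)
Class coding (A : Type) := Coding {
  enc : A -> nat;
  unenc : nat -> A;
  encK : cancel enc unenc;
  unencK : cancel unenc enc }.

#[local] Hint Mode coding ! : typeclass_instances.

#[local] Instance coding_nat : coding nat :=
  @Coding nat id id (fun=> erefl) (fun=> erefl).

Section CodingProd.
Context {A B : Type} {cA : coding A} {cB : coding B}.
Definition enc_prod (p : A * B) := Cantor.to_nat (enc p.1, enc p.2).
Definition unenc_prod n : A * B :=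
  (unenc (Cantor.of_nat n).1, unenc (Cantor.of_nat n).2).

Lemma enc_prodK : cancel enc_prod unenc_prod.
Proof. by move=> [a b]; rewrite /unenc_prod Cantor.cancel_of_to /= !encK. Qed.

Lemma unenc_prodK : cancel unenc_prod enc_prod.
Proof.
move=> n; rewrite -[RHS]Cantor.cancel_to_of /unenc_prod.
case: (Cantor.of_nat n) => x y; congr (Cantor.to_nat (_, _)); exact: unencK.
Qed.
End CodingProd.

#[local] Instance coding_prod A B (cA : coding A) (cB : coding B) : coding (A * B) :=
  Coding enc_prodK unenc_prodK.

Section CodingSeq.
Context {A : Type} {cA : coding A}.
Definition enc_seq (l : seq A) := CodeSeq.code (map enc l).
Definition unenc_seq n : seq A := map unenc (CodeSeq.decode n).

Lemma enc_seqK : cancel enc_seq unenc_seq.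
Proof. by move=> l; rewrite /unenc_seq CodeSeq.codeK mapK//; exact: encK. Qed.

Lemma unenc_seqK : cancel unenc_seq enc_seq.
Proof. by move=> n; rewrite /enc_seq mapK ?CodeSeq.decodeK//; exact: unencK. Qed.
End CodingSeq.

#[local] Instance coding_seq A (cA : coding A) : coding (seq A) :=
  Coding enc_seqK unenc_seqK.

Section Computable.
Context {A B C : Type} {cA : coding A} {cB : coding B} {cC : coding C}.

Definition computable (F : A -> B) :=
  exists f : recfun 1, forall a, computes f [tuple enc a] (enc (F a)).

Lemma computableP F : computable F <-> op1 (fun n => enc (F (unenc n))).
Proof.
split=> -[f Hf]; exists f.
  move=> v; have := Hf (@unenc A cA (tnth v ord0)); rewrite unencK.
  suff -> : [tuple tnth v ord0] = v by [].
  by apply: eq_from_tnth => i; rewrite [i]ord1 !(tnth_nth 0).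
by move=> a; rewrite -[X in enc (F X)]encK; exact: (Hf [tuple enc a]).
Qed.

Lemma computable_ext (F G : A -> B) : F =1 G -> computable F -> computable G.
Proof. by move=> FG [f Hf]; exists f => a; rewrite -FG. Qed.

Lemma computable_const (b : B) : computable (fun _ : A => b).
Proof. by apply/computableP; exact: total_const. Qed.
End Computable.

Lemma computable_id {A} {cA : coding A} : computable (fun a : A => a).
Proof.
by apply/computableP; apply: total_ext (total_proj _) => v /=; rewrite unencK.
Qed.

Section ComputableTheory.
Context {A B C : Type} {cA : coding A} {cB : coding B} {cC : coding C}.

Lemma computable_comp (F : B -> C) (G : A -> B) :
  computable F -> computable G -> computable (fun a => F (G a)).
Proof.
move=> /computableP hF /computableP hG; apply/computableP.
by have := total_op1 hF hG; apply: total_ext => v; rewrite encK.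
Qed.

Lemma computable_op2 (H : nat -> nat -> nat) (F G : A -> nat) :
  op2 H -> computable F -> computable G -> computable (fun a => H (F a) (G a)).
Proof.
by move=> hH /computableP hF /computableP hG; apply/computableP; exact: total_op2.
Qed.

Lemma computable_op1 (H : nat -> nat) (F : A -> nat) :
  op1 H -> computable F -> computable (fun a => H (F a)).
Proof.
by move=> hH /computableP hF; apply/computableP; exact: (total_op1 hH hF).
Qed.

Lemma computable_pair (F : A -> B) (G : A -> C) :
  computable F -> computable G -> computable (fun a => (F a, G a)).
Proof.
move=> /computableP hF /computableP hG; apply/computableP.
exact: (total_op2 op2_pair hF hG).
Qed.

Lemma computable_fst (F : A -> B * C) : computable F -> computable (fun a => (F a).1).
Proof.
move=> /computableP hF; apply/computableP.
by have := total_op1 op1_unpair1 hF; apply: total_ext => v; rewrite Cantor.cancel_of_to.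
Qed.

Lemma computable_snd (F : A -> B * C) : computable F -> computable (fun a => (F a).2).
Proof.
move=> /computableP hF; apply/computableP.
by have := total_op1 op1_unpair2 hF; apply: total_ext => v; rewrite Cantor.cancel_of_to.
Qed.

(** [computable] speaks of codes only, so encoding is performed by the identity program; so is
    decoding, because codes are bijective. *)
Lemma computable_enc (F : A -> B) : computable F -> computable (fun a => enc (F a)).
Proof. by []. Qed.

Lemma computable_unenc (F : A -> nat) :
  computable F -> computable (fun a => unenc (F a) : B).
Proof. by move=> [f Hf]; exists f => a; rewrite unencK. Qed.

Lemma computable_rec (F : A -> B) (G : A -> nat -> B -> B) (N : A -> nat) :
  computable F -> computable (fun p : A * (nat * B) => G p.1 p.2.1 p.2.2) ->
  computable N ->
  computable (fun a => nat_rect (fun=> B) (F a) (G a) (N a)).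
Proof.
move=> /computableP hF /computableP hG hN.
pose eB := @enc B cB; pose dA := @unenc A cA.
(* [op2_rec] wants the counter first and a numerical parameter, so the recursion runs on codes, with
   [y] the code of the parameter. *)
pose H t y := eB (nat_rect (fun=> B) (F (dA y)) (G (dA y)) t).
have hH : op2 H.
  apply: (op2_rec (F := fun y => eB (F (dA y)))
    (G := fun t u y => eB (G (dA y) t (unenc u)))) => //.
  + have := total_op1 hG (total_op2 op2_pair (total_proj (n := 3) (inord 2))
      (total_op2 op2_pair (total_proj ord0) (total_proj (inord 1)))).
    by apply: total_ext => v; rewrite /= /unenc_prod !Cantor.cancel_of_to.
  + by move=> t y; rewrite /H /eB /= encK.
have [f Hf] := computable_unenc (computable_op2 hH hN (@computable_id A cA)).
by exists f => a; have := Hf a; rewrite /H /eB /dA !encK.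
Qed.

End ComputableTheory.

Lemma computable_comp2 {A B C D} {cA : coding A} {cB : coding B} {cC : coding C}
    {cD : coding D} (F : B -> C -> D) (G1 : A -> B) (G2 : A -> C) :
  computable (fun p : B * C => F p.1 p.2) -> computable G1 -> computable G2 ->
  computable (fun a => F (G1 a) (G2 a)).
Proof.
move=> hF h1 h2.
exact: (computable_comp (G := fun a => (G1 a, G2 a)) hF (computable_pair h1 h2)).
Qed.

Lemma computable_succ {A} {cA : coding A} (F : A -> nat) :
  computable F -> computable (fun a => (F a).+1).
Proof. by move=> hF; apply: computable_op1 => //; exact: op1S. Qed.

Lemma computable_pred {A} {cA : coding A} (F : A -> nat) :
  computable F -> computable (fun a => (F a).-1).
Proof. by move=> hF; apply: computable_op1 => //; exact: op1_pred. Qed.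

Lemma computable_exp2 {A} {cA : coding A} (F : A -> nat) :
  computable F -> computable (fun a => 2 ^ F a).
Proof. by move=> hF; apply: computable_op1 => //; exact: op1_exp2. Qed.

Lemma computable_addn {A} {cA : coding A} (F G : A -> nat) :
  computable F -> computable G -> computable (fun a => F a + G a).
Proof. by move=> hF hG; apply: computable_op2 => //; exact: op2_addn. Qed.

Lemma computable_muln {A} {cA : coding A} (F G : A -> nat) :
  computable F -> computable G -> computable (fun a => F a * G a).
Proof. by move=> hF hG; apply: computable_op2 => //; exact: op2_muln. Qed.

Lemma computable_subn {A} {cA : coding A} (F G : A -> nat) :
  computable F -> computable G -> computable (fun a => F a - G a).
Proof. by move=> hF hG; apply: computable_op2 => //; exact: op2_subn. Qed.

Lemma computable_double {A} {cA : coding A} (F : A -> nat) :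
  computable F -> computable (fun a => (F a).*2).
Proof.
move=> hF; apply: computable_ext (computable_addn hF hF) => a; exact: addnn.
Qed.

(** [CodeSeq.code (n :: l)] is [2 ^ n * (2 * CodeSeq.code l).+1], so consing is plain arithmetic. *)
Lemma computable_cons {A B} {cA : coding A} {cB : coding B}
    (F : A -> B) (G : A -> seq B) :
  computable F -> computable G -> computable (fun a => F a :: G a).
Proof.
move=> hF hG.
exact: (computable_muln (computable_exp2 hF) (computable_succ (computable_double hG))).
Qed.

(** * Decidable and semi-decidable predicates *)

Definition decidable_pred {A} {cA : coding A} (P : A -> bool) :=
  computable (fun a => nat_of_bool (P a)).

Lemma dec_leq {A} {cA : coding A} (F G : A -> nat) :
  computable F -> computable G -> decidable_pred (fun a => F a <= G a).
Proof.
move=> hF hG.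
apply: computable_ext (computable_subn (computable_const 1) (computable_subn hF hG)) => a.
by rewrite /leq; case: (F a - G a) => // n; rewrite subSS sub0n.
Qed.

Lemma dec_neg {A} {cA : coding A} (P : A -> bool) :
  decidable_pred P -> decidable_pred (fun a => ~~ P a).
Proof.
move=> hP; apply: computable_ext (computable_subn (computable_const 1) hP) => a.
by case: (P a).
Qed.

Lemma dec_and {A} {cA : coding A} (P Q : A -> bool) :
  decidable_pred P -> decidable_pred Q -> decidable_pred (fun a => P a && Q a).
Proof.
move=> hP hQ; apply: computable_ext (computable_muln hP hQ) => a.
by case: (P a); case: (Q a).
Qed.

Lemma dec_or {A} {cA : coding A} (P Q : A -> bool) :
  decidable_pred P -> decidable_pred Q -> decidable_pred (fun a => P a || Q a).
Proof.
move=> hP hQ; apply: computable_ext (dec_neg (dec_and (dec_neg hP) (dec_neg hQ))) => a.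
by case: (P a); case: (Q a).
Qed.

Lemma dec_eqn {A} {cA : coding A} (F G : A -> nat) :
  computable F -> computable G -> decidable_pred (fun a => F a == G a).
Proof.
move=> hF hG.
by apply: computable_ext (dec_and (dec_leq hF hG) (dec_leq hG hF)) => a; rewrite eqn_leq.
Qed.

Lemma computable_sum {A} {cA : coding A} (F : A -> nat -> nat) (N : A -> nat) :
  computable (fun p : A * nat => F p.1 p.2) -> computable N ->
  computable (fun a => \sum_(i < N a) F a i).
Proof.
move=> hF hN.
have hG : computable (fun p : A * (nat * nat) => p.2.2 + F p.1 p.2.1).
  apply: computable_addn; first exact: computable_snd (computable_snd computable_id).
  apply: (computable_comp2 hF); first exact: computable_fst computable_id.
  exact: computable_fst (computable_snd computable_id).
have := computable_rec (computable_const 0) (G := fun a t u => u + F a t) hG hN.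
apply: computable_ext => a; elim: (N a) => [|n IHn]; first by rewrite big_ord0.
by rewrite big_ord_recr /= IHn.
Qed.

Lemma dec_forall_lt {A} {cA : coding A} (P : A -> nat -> bool) (N : A -> nat) :
  decidable_pred (fun p : A * nat => P p.1 p.2) -> computable N ->
  decidable_pred (fun a => [forall i : 'I_(N a), P a i]).
Proof.
move=> hP hN.
have := dec_eqn (computable_sum (F := fun a i => ~~ P a i) (dec_neg hP) hN) (computable_const 0).
apply: computable_ext => a; congr nat_of_bool; apply/idP/idP.
  by rewrite sum_nat_eq0 => /forallP H; apply/forallP => i; have := H i; case: (P a i).
by move=> /forallP H; rewrite sum_nat_eq0; apply/forallP => i; rewrite H.
Qed.

Lemma computable_mu {A} {cA : coding A} (Q : A -> nat -> bool) (F : A -> nat) :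
  decidable_pred (fun p : A * nat => Q p.1 p.2) ->
  (forall a, Q a (F a)) -> (forall a z, z < F a -> ~~ Q a z) -> computable F.
Proof.
move=> /dec_neg/computableP hQ QF QF'; apply/computableP.
pose q (v : 2.-tuple nat) : nat := ~~ Q (@unenc A cA (tnth v (inord 1))) (tnth v ord0).
apply: (@total_mu 1 q).
- have := total_op1 hQ (total_op2 op2_pair (total_proj (n := 2) (inord 1)) (total_proj ord0)).
  by apply: total_ext => v; rewrite /= Cantor.cancel_of_to.
- by move=> v; rewrite /q !(tnth_nth 0) inordK//= QF.
- by move=> v z /QF'; rewrite /q !(tnth_nth 0) inordK//= => ->.
Qed.

(** With the stage [n] explicit, connectives and quantifiers are handled by coding stages, without
    building programs; [re_semi] and [semi_re] translate from and to [recursively_enumerable]. *)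
Definition semidecidable {A} {cA : coding A} (P : A -> Prop) :=
  exists2 Q : A -> nat -> bool, decidable_pred (fun p : A * nat => Q p.1 p.2) &
    forall a, P a <-> exists n, Q a n.

Lemma semi_ext {A} {cA : coding A} (P Q : A -> Prop) :
  (forall a, P a <-> Q a) -> semidecidable P -> semidecidable Q.
Proof.
by move=> PQ [S hS SP]; exists S => // a; rewrite -PQ.
Qed.

Lemma dec_semi {A} {cA : coding A} (P : A -> bool) :
  decidable_pred P -> semidecidable P.
Proof.
move=> hP; exists (fun a _ => P a); last by move=> a; split=> [Pa|[]//]; exists 0.
exact: (computable_comp (F := fun a => nat_of_bool (P a)) hP (computable_fst computable_id)).
Qed.

Lemma semi_comp {A B} {cA : coding A} {cB : coding B} (P : B -> Prop) (F : A -> B) :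
  semidecidable P -> computable F -> semidecidable (fun a => P (F a)).
Proof.
move=> [Q hQ QP] hF; exists (fun a n => Q (F a) n) => [|a]; last exact: QP.
apply: (computable_comp2 (F := fun p n => nat_of_bool (Q p n)) hQ);
  last exact: computable_snd computable_id.
exact: (computable_comp hF (computable_fst computable_id)).
Qed.

(** Dovetailing: one number codes both the witness and the stage at which it is confirmed.
    Bijectivity of codes makes every number a legitimate candidate. *)
Lemma semi_exists {A B} {cA : coding A} {cB : coding B} (P : A -> B -> Prop) :
  semidecidable (fun p : A * B => P p.1 p.2) ->
  semidecidable (fun a => exists b, P a b).
Proof.
move=> [Q hQ QP].
have h : computable (fun p : A * nat => unenc p.2 : B * nat).
  exact: computable_unenc (computable_snd computable_id).
exists (fun a n => Q (a, (unenc n : B * nat).1) (unenc n : B * nat).2).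
  apply: (computable_comp2 (F := fun p n => nat_of_bool (Q p n)) hQ);
    last exact: computable_snd.
  by apply: computable_pair; [exact: computable_fst computable_id|exact: computable_fst].
move=> a; split.
  move=> [b /(QP (a, b))[n Hn]]; exists (enc (b, n)).
  by rewrite [unenc _]encK.
by move=> [n Hn]; exists (unenc n : B * nat).1; apply/(QP (a, _));
  exists (unenc n : B * nat).2.
Qed.

Lemma semi_and {A} {cA : coding A} (P Q : A -> Prop) :
  semidecidable P -> semidecidable Q -> semidecidable (fun a => P a /\ Q a).
Proof.
move=> [P' hP' PP] [Q' hQ' QQ].
have : semidecidable (fun a => exists p : nat * nat, P' a p.1 && Q' a p.2).
  apply: (semi_exists (P := fun a (p : nat * nat) => P' a p.1 && Q' a p.2)).
  apply: dec_semi; apply: dec_and.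
  + apply: (computable_comp2 (F := fun a n => nat_of_bool (P' a n)) hP').
      exact: computable_fst computable_id.
    exact: computable_fst (computable_snd computable_id).
  + apply: (computable_comp2 (F := fun a n => nat_of_bool (Q' a n)) hQ').
      exact: computable_fst computable_id.
    exact: computable_snd (computable_snd computable_id).
apply: semi_ext => a; rewrite PP QQ; split.
  by move=> [[n m] /andP[/= Pn Qm]]; split; [exists n|exists m].
by move=> [[n Pn] [m Qm]]; exists (n, m); rewrite /= Pn.
Qed.

Lemma semi_or {A} {cA : coding A} (P Q : A -> Prop) :
  semidecidable P -> semidecidable Q -> semidecidable (fun a => P a \/ Q a).
Proof.
move=> [P' hP' PP] [Q' hQ' QQ]; exists (fun a n => P' a n || Q' a n); first exact: dec_or.
move=> a; rewrite PP QQ; split.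
  by case=> -[n Hn]; exists n; rewrite Hn ?orbT.
by move=> [n /orP[] Hn]; [left|right]; exists n.
Qed.

Ltac computability := repeat first
  [ assumption
  | apply computable_id
  | apply computable_const
  | lazymatch goal with
    | |- computable fst => exact (computable_fst computable_id)
    | |- computable snd => exact (computable_snd computable_id)
    | |- computable (fun _ => (_, _)) => apply computable_pair
    | |- computable (fun _ => _ :: _) => apply computable_cons
    | |- computable (fun _ => fst _) => apply computable_fst
    | |- computable (fun _ => snd _) => apply computable_snd
    | |- computable (fun _ => S _) => apply computable_succ
    | |- computable (fun _ => (_ + _)%N) => apply computable_addn
    | |- computable (fun _ => (_ * _)%N) => apply computable_muln
    | |- computable (fun _ => expn 2 _) => apply computable_exp2
    | |- computable (fun _ => unenc _) => apply computable_unenc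
    | |- computable (fun _ => enc _) => apply computable_enc
    end ].

Lemma semi_eq {A B} {cA : coding A} {cB : coding B} (F G : A -> B) :
  computable F -> computable G -> semidecidable (fun a => F a = G a).
Proof.
move=> hF hG;
  apply: semi_ext (dec_semi (dec_eqn (computable_enc hF) (computable_enc hG))) => a.
by split=> [/eqP/(can_inj (@encK B cB))|->].
Qed.

Lemma semi_leq {A} {cA : coding A} (F G : A -> nat) :
  computable F -> computable G -> semidecidable (fun a => F a <= G a).
Proof. by move=> hF hG; exact: (dec_semi (dec_leq hF hG)). Qed.

(** The search for a code of a pair (value, stage) terminates because [F] is total, and whatever it
    finds carries the right value. The list destructors below are obtained in this way, their graphs
    being described with [cons] alone. *)
Lemma computable_graph {A B} {cA : coding A} {cB : coding B} (F : A -> B) :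
  semidecidable (fun p : A * B => p.2 = F p.1) -> computable F.
Proof.
move=> [Q hQ QF].
set d := @unenc (B * nat) (coding_prod cB coding_nat).
have ex a : exists n, Q (a, (d n).1) (d n).2.
  have /QF[n Hn] : (a, F a).2 = F (a, F a).1 by [].
  by exists (enc_prod (F a, n)); rewrite /d [unenc _]enc_prodK.
pose M a := ex_minn (ex a).
have hM : computable M.
  apply: (computable_mu (Q := fun a n => Q (a, (d n).1) (d n).2)).
  - by apply: (computable_comp2 (F := fun p n => nat_of_bool (Q p n)) hQ); rewrite /d;
    computability.
  - by move=> a; rewrite /M; case: ex_minnP.
  - by move=> a z; rewrite /M; case: ex_minnP => m _ mz zm; apply/negP => /mz;
    rewrite leqNgt zm.
apply: (computable_ext (F := fun a => (d (M a)).1)); last by rewrite /d; computability.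
move=> a; rewrite /M; case: ex_minnP => m Hm _.
by apply/(QF (_, _)); exists (d m).2.
Qed.

Section Lists.
Context {A B : Type} {cA : coding A} {cB : coding B}.

Lemma computable_behead (L : A -> seq B) :
  computable L -> computable (fun a => behead (L a)).
Proof.
apply: computable_comp; apply: computable_graph.
apply: (semi_ext (P := fun p : seq B * seq B =>
  (p.1 = [::] /\ p.2 = [::]) \/ exists x, p.1 = x :: p.2)).
  move=> [[|x l] l'] /=; split.
  - by move=> [[]|[]].
  - by move=> ->; left.
  - by move=> [[]|[y] [= _ ->]].
  - by move=> ->; right; exists x.
apply: semi_or; first by apply: semi_and; apply: semi_eq; computability.
by apply: (semi_exists (P := fun (p : seq B * seq B) x => p.1 = x :: p.2));
  apply: semi_eq; computability.
Qed.

Lemma computable_head x0 (L : A -> seq B) :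
  computable L -> computable (fun a => head x0 (L a)).
Proof.
apply: computable_comp; apply: computable_graph.
apply: (semi_ext (P := fun p : seq B * B =>
  (p.1 = [::] /\ p.2 = x0) \/ exists l, p.1 = p.2 :: l)).
  move=> [[|x l] y] /=; split.
  - by move=> [[]|[]].
  - by move=> ->; left.
  - by move=> [[]|[?] [= -> _]].
  - by move=> ->; right; exists l.
apply: semi_or; first by apply: semi_and; apply: semi_eq; computability.
by apply: (semi_exists (P := fun (p : seq B * B) l => p.1 = p.2 :: l));
  apply: semi_eq; computability.
Qed.

End Lists.

Lemma computable_drop {A B} {cA : coding A} {cB : coding B} (L : A -> seq B) (N : A -> nat) :
  computable L -> computable N -> computable (fun a => drop (N a) (L a)).
Proof.
move=> hL hN.
have hG : computable (fun p : A * (nat * seq B) => behead p.2.2).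
  exact: (computable_comp (F := behead) (computable_behead computable_id)
    (computable_snd (computable_snd computable_id))).
have := computable_rec (G := fun a t u => behead u) hL hG hN.
apply: computable_ext => a; elim: (N a) => [|n IHn] /=; first by rewrite drop0.
by rewrite IHn -drop1 drop_drop add1n.
Qed.

Lemma computable_nth {A B} {cA : coding A} {cB : coding B} x0 (L : A -> seq B) (N : A -> nat) :
  computable L -> computable N -> computable (fun a => nth x0 (L a) (N a)).
Proof.
move=> hL hN;
  have := computable_comp (computable_head x0 computable_id) (computable_drop hL hN).
by apply: computable_ext => a; rewrite -nth0 nth_drop addn0.
Qed.

Lemma computable_size {A B} {cA : coding A} {cB : coding B} (L : A -> seq B) :
  computable L -> computable (fun a => size (L a)).
Proof.
move=> hL.
apply: (computable_mu (Q := fun a n => enc (drop n (L a)) == enc ([::] : seq B))).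
- apply: dec_eqn; last exact: computable_const.
  apply: computable_enc; apply: computable_drop; last by computability.
  by apply: (computable_comp hL); computability.
- by move=> a; rewrite drop_size.
- move=> a z zL; apply/negP => /eqP/(can_inj (@encK _ (coding_seq cB)))/(congr1 size)/eqP.
  by rewrite size_drop subn_eq0 leqNgt zL.
Qed.

Ltac computability ::= repeat first
  [ assumption
  | apply computable_id
  | apply computable_const
  | lazymatch goal with
    | |- computable fst => exact (computable_fst computable_id)
    | |- computable snd => exact (computable_snd computable_id)
    | |- computable (fun _ => (_, _)) => apply computable_pair
    | |- computable (fun _ => _ :: _) => apply computable_cons
    | |- computable (fun _ => fst _) => apply computable_fst
    | |- computable (fun _ => snd _) => apply computable_snd
    | |- computable (fun _ => S _) => apply computable_succ
    | |- computable (fun _ => (_ + _)%N) => apply computable_addn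
    | |- computable (fun _ => (_ * _)%N) => apply computable_muln
    | |- computable (fun _ => expn 2 _) => apply computable_exp2
    | |- computable (fun _ => unenc _) => apply computable_unenc
    | |- computable (fun _ => enc _) => apply computable_enc
    | |- computable (fun _ => nth _ _ _) => apply computable_nth
    | |- computable (fun _ => size _) => apply computable_size
    | |- computable (fun _ => behead _) => apply computable_behead
    end ].

(** A bounded quantifier commutes with the search: the finitely many stages are collected into one
    list [w], after which only a bounded decidable check remains. *)
Lemma semi_forall_lt {A} {cA : coding A} (P : A -> nat -> Prop) (N : A -> nat) :
  semidecidable (fun p : A * nat => P p.1 p.2) -> computable N ->
  semidecidable (fun a => forall i, i < N a -> P a i).
Proof.
move=> [Q hQ QP] hN.
apply: (semi_ext (P := fun a => exists w : seq nat, [forall i : 'I_(N a), Q (a, val i) (nth 0 w i)])).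
  move=> a; split.
    by move=> [w /forallP Hw] i iN; apply/(QP (a, i)); exists (nth 0 w i);
      exact: (Hw (Ordinal iN)).
  move=> H; have /choice[w Hw] i : exists n, i < N a -> Q (a, i) n.
    by case: (ltnP i (N a)) => [/H/(QP (a, i))[n Hn]|]; [exists n|exists 0].
  exists (mkseq w (N a)); apply/forallP => i; have iN := ltn_ord i.
  by rewrite nth_mkseq//; exact: Hw.
apply: (semi_exists (P := fun a (w : seq nat) => [forall i : 'I_(N a), Q (a, val i) (nth 0 w i)])).
apply: dec_semi.
apply: (dec_forall_lt (P := fun (p : A * seq nat) i => Q (p.1, i) (nth 0 p.2 i))).
  by apply: (computable_comp2 (F := fun p n => nat_of_bool (Q p n)) hQ); computability.
by apply: (computable_comp hN); computability.
Qed.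

(** Each [i] may come with its own algorithm, without uniformity in [i]; this is the situation of
    the family [g] in a program [Comp f g]. Hence the induction over an enumeration of [I]. *)
Lemma semi_forall_fin {A} {cA : coding A} (I : finType) (P : I -> A -> Prop) :
  (forall i, semidecidable (P i)) -> semidecidable (fun a => forall i, P i a).
Proof.
move=> hP; have h (s : seq I) : semidecidable (fun a => forall i, i \in s -> P i a).
  elim: s => [|j s IHs].
    by apply: semi_ext (semi_eq (computable_const 0) (computable_const 0)) => a; split.
  apply: semi_ext (semi_and (hP j) IHs) => a; split.
    by move=> [Pj Ps] i; rewrite inE => /orP[/eqP->|/Ps].
  by move=> H; split=> [|i si]; apply: H; rewrite inE ?eqxx// si orbT.
by apply: semi_ext (h (enum I)) => a; split=> H i;
  [apply: H; rewrite mem_enum|move=> _; exact: H].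
Qed.

Lemma semi_mem {A} {cA : coding A} (F : A -> nat) (L : A -> seq nat) :
  computable F -> computable L -> semidecidable (fun a => F a \in L a).
Proof.
move=> hF hL.
apply: (semi_ext (P := fun a => exists i, i < size (L a) /\ F a = nth 0 (L a) i)).
  by move=> a; split=> [[i [iL ->]]|/(nthP 0)[i iL <-]]; [exact: mem_nth|exists i].
apply: (semi_exists (P := fun a i => i < size (L a) /\ F a = nth 0 (L a) i)).
have h : computable (fun p : A * nat => L p.1) by apply: (computable_comp hL);
  computability.
apply: semi_and; first by apply: semi_leq; computability.
by apply: semi_eq; computability; apply: (computable_comp hF); computability.
Qed.

Lemma semi_forall_mem {A} {cA : coding A} (P : A -> nat -> Prop) (L : A -> seq nat) :
  semidecidable (fun p : A * nat => P p.1 p.2) -> computable L ->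
  semidecidable (fun a => forall x, x \in L a -> P a x).
Proof.
move=> hP hL.
apply: (semi_ext (P := fun a => forall i, i < size (L a) -> P a (nth 0 (L a) i))).
  by move=> a; split=> [H x /(nthP 0)[i iL <-]|H i iL]; apply: H => //; exact: mem_nth.
apply: (semi_forall_lt (P := fun a i => P a (nth 0 (L a) i))); last by computability.
have h : computable (fun p : A * nat => L p.1) by apply: (computable_comp hL);
  computability.
by apply: (semi_comp (F := fun p : A * nat => (p.1, nth 0 (L p.1) p.2)) hP);
  computability.
Qed.

Lemma semi_exists_mem {A} {cA : coding A} (P : A -> nat -> Prop) (L : A -> seq nat) :
  semidecidable (fun p : A * nat => P p.1 p.2) -> computable L ->
  semidecidable (fun a => exists2 x, x \in L a & P a x).
Proof.
move=> hP hL.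
apply: (semi_ext (P := fun a => exists x, x \in L a /\ P a x)).
  by move=> a; split=> [[x []]|[x]]; exists x.
apply: (semi_exists (P := fun a x => x \in L a /\ P a x)); apply: semi_and => //.
by apply: semi_mem; computability; apply: (computable_comp hL); computability.
Qed.

(** Lists are coded, tuples of varying length are not. A list is cut or padded with zeros to the
    required length, so that a search for a tuple may range over all lists. *)
Definition ntup n (l : seq nat) : n.-tuple nat := [tuple nth 0 l i | i < n].

Lemma ntupK n (v : n.-tuple nat) : ntup n v = v.
Proof. by apply: eq_from_tnth => i; rewrite tnth_mktuple (tnth_nth 0). Qed.

Lemma ntup_cons n x l : ntup n.+1 (x :: l) = cons_tuple x (ntup n l).
Proof.
apply: eq_from_tnth => i; rewrite tnth_mktuple (tnth_nth 0).
case: i => -[//|i] /= ilt; rewrite /ntup.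
by have := tnth_mktuple (fun i : 'I_n => nth 0 l i) (Ordinal (ilt : i < n));
  rewrite (tnth_nth 0).
Qed.

Lemma behead_ntup n l : behead_tuple (ntup n.+1 l) = ntup n (behead l).
Proof.
apply: eq_from_tnth => i; rewrite tnth_behead !tnth_mktuple.
by case: l => [|x l] /=; rewrite inordK ?ltnS ?nth_nil.
Qed.

Lemma thead_ntup n l : thead (ntup n.+1 l) = nth 0 l 0.
Proof. by rewrite /thead tnth_mktuple. Qed.

(** By induction on the program, each clause of [computes] is rewritten with finite data: the tuple
    [w] of intermediate values and the history [u] of a recursion become lists that can be searched
    for. *)
Lemma semi_computes n (f : recfun n) :
  semidecidable (fun p : seq nat * nat => computes f (ntup n p.1) p.2).
Proof.
elim: f => {n} [n||n i|n k f IHf g IHg|n f IHf g IHg|n f IHf] /=.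
- by apply: semi_eq; computability.
- apply: (semi_ext (P := fun p : seq nat * nat => p.2 = (nth 0 p.1 0).+1)).
    by move=> p; rewrite thead_ntup.
  by apply: semi_eq; computability.
- apply: (semi_ext (P := fun p : seq nat * nat => p.2 = nth 0 p.1 i)).
    by move=> p; rewrite tnth_mktuple.
  by apply: semi_eq; computability.
- apply: (semi_ext (P := fun p : seq nat * nat => exists w : seq nat,
    (forall i, computes (g i) (ntup n p.1) (nth 0 w i)) /\ computes f (ntup k w) p.2)).
    move=> p; split=> [[w [gw fw]]|[w [gw fw]]].
      by exists (ntup k w); split=> // i; rewrite tnth_mktuple.
    by exists w; split=> [i|]; rewrite ?ntupK// -tnth_nth.
  apply: (semi_exists (P := fun (p : seq nat * nat) (w : seq nat) =>
    (forall i, computes (g i) (ntup n p.1) (nth 0 w i)) /\ computes f (ntup k w) p.2)).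
  apply: semi_and.
    apply: (semi_forall_fin (P := fun i (p : (seq nat * nat) * seq nat) =>
      computes (g i) (ntup n p.1.1) (nth 0 p.2 i))) => i.
    by apply: (semi_comp (F := fun p : (seq nat * nat) * seq nat => (p.1.1, nth 0 p.2 i)) (IHg i));
      computability.
  by apply: (semi_comp (F := fun p : (seq nat * nat) * seq nat => (p.2, p.1.2)) IHf);
    computability.
- apply: (semi_ext (P := fun p : seq nat * nat => exists u : seq nat,
    computes f (ntup n (behead p.1)) (nth 0 u 0) /\
    ((forall t, t < nth 0 p.1 0 ->
      computes g (ntup n.+2 (t :: nth 0 u t :: behead p.1)) (nth 0 u t.+1)) /\
    p.2 = nth 0 u (nth 0 p.1 0)))).
    move=> [l y] /=; rewrite behead_ntup thead_ntup;
      split=> [[u [f0 [gS ->]]]|[u [f0 gS ->]]].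
      by exists (nth 0 u); split=> // t /gS; rewrite !ntup_cons.
    (* Only the values of [u] up to and including the recursion argument matter. *)
    exists (mkseq u (nth 0 l 0).+1); rewrite !nth_mkseq//; split=> //; split=> // t tl.
    by rewrite !ntup_cons !nth_mkseq ?ltnS//; [exact: gS|exact: ltnW].
  apply: (semi_exists (P := fun (p : seq nat * nat) (u : seq nat) =>
    computes f (ntup n (behead p.1)) (nth 0 u 0) /\
    ((forall t, t < nth 0 p.1 0 ->
      computes g (ntup n.+2 (t :: nth 0 u t :: behead p.1)) (nth 0 u t.+1)) /\
    p.2 = nth 0 u (nth 0 p.1 0)))).
  apply: semi_and.
    by apply: (semi_comp (F := fun p : (seq nat * nat) * seq nat =>
      (behead p.1.1, nth 0 p.2 0)) IHf); computability.
  apply: semi_and; last by apply: semi_eq; computability.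
  apply: (semi_forall_lt (P := fun (p : (seq nat * nat) * seq nat) t =>
    computes g (ntup n.+2 (t :: nth 0 p.2 t :: behead p.1.1)) (nth 0 p.2 t.+1)));
    last by computability.
  by apply: (semi_comp (F := fun p : ((seq nat * nat) * seq nat) * nat =>
    (p.2 :: nth 0 p.1.2 p.2 :: behead p.1.1.1, nth 0 p.1.2 p.2.+1)) IHg); computability.
- apply: (semi_ext (P := fun p : seq nat * nat =>
    computes f (ntup n.+1 (p.2 :: p.1)) 0 /\
    forall z, z < p.2 -> exists w, computes f (ntup n.+1 (z :: p.1)) w.+1)).
    by move=> [l y] /=; rewrite !ntup_cons; split=> -[fy Hz]; split=> // z /Hz;
      rewrite ntup_cons.
  apply: semi_and.
    by apply: (semi_comp (F := fun p : seq nat * nat => (p.2 :: p.1, 0)) IHf);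
      computability.
  apply: (semi_forall_lt (P := fun (p : seq nat * nat) z =>
    exists w, computes f (ntup n.+1 (z :: p.1)) w.+1)); last by computability.
  apply: (semi_exists (P := fun (p : (seq nat * nat) * nat) w =>
    computes f (ntup n.+1 (p.2 :: p.1.1)) w.+1)).
  by apply: (semi_comp (F := fun p : ((seq nat * nat) * nat) * nat =>
    (p.1.2 :: p.1.1.1, p.2.+1)) IHf); computability.
Qed.

Lemma ntup1 k : ntup 1 [:: k] = [tuple k].
Proof. by apply: eq_from_tnth => i; rewrite tnth_mktuple [i]ord1. Qed.

Lemma semi_halts {A} {cA : coding A} (f : recfun 1) (F : A -> nat) :
  computable F -> semidecidable (fun a => halts f [tuple F a]).
Proof.
move=> hF; apply: (semi_exists (P := fun a y => computes f [tuple F a] y)).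
apply: (semi_ext (P := fun p : A * nat => computes f (ntup 1 [:: F p.1]) p.2)).
  by move=> p; rewrite ntup1.
apply: (semi_comp (F := fun p : A * nat => ([:: F p.1], p.2)) (semi_computes f));
  computability.
by apply: (computable_comp hF); computability.
Qed.

Lemma re_semi (E : set nat) : recursively_enumerable E ->
  semidecidable (fun i : nat => E i).
Proof.
move=> [f ->]; apply: (semi_exists (P := fun i n : nat => computes f [tuple n] i)).
apply: (semi_ext (P := fun p : nat * nat => computes f (ntup 1 [:: p.2]) p.1)).
  by move=> p; rewrite ntup1.
by apply: (semi_comp (F := fun p : nat * nat => ([:: p.2], p.1)) (semi_computes f));
  computability.
Qed.

Lemma uniformly_re_semi (E : nat -> set nat) :
  uniformly_re E -> semidecidable (fun p : nat * nat => E p.1 p.2).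
Proof.
move=> /re_semi hE; apply: semi_ext (semi_comp hE (F := fun p : nat * nat => enc p) _).
  by move=> [n i] /=; rewrite /enc_prod Cantor.cancel_of_to.
by computability.
Qed.

(** The set must be the range of a program. The one built here computes, from [i], a stage for [i]
    by minimization and [i] itself, then projects to [i]. Since a composition needs all its
    components to halt, it halts on [i] exactly when a stage exists. *)
Lemma semi_re (P : nat -> Prop) : semidecidable P -> recursively_enumerable [set i | P i].
Proof.
move=> [Q /dec_neg/computableP hQ QP].
have [q Hq] : total_rec (fun v : 2.-tuple nat => nat_of_bool (~~ Q (tnth v (inord 1)) (tnth v ord0))).
  have := total_op1 hQ (total_op2 op2_pair (total_proj (n := 2) (inord 1)) (total_proj ord0)).
  by apply: total_ext => v; rewrite /= /unenc_prod Cantor.cancel_of_to.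
have {}Hq z i : computes q (cons_tuple z [tuple i]) (~~ Q i z).
  by have := Hq (cons_tuple z [tuple i]); rewrite !(tnth_nth 0) inordK.
pose g (i : 'I_2) : recfun 1 := if i == ord0 then Mu q else Proj ord0.
exists (Comp (Proj (inord 1 : 'I_2)) g); apply/seteqP; split=> i /=.
  move=> /QP ex; exists i; pose z := ex_minn ex.
  exists [tuple z; i]; split; last by rewrite (tnth_nth 0) inordK.
  move=> j; rewrite /g (tnth_nth 0); case: j => -[|[|//]] j2 //=.
  rewrite /z; case: ex_minnP => m Qm minm; split; first by have := Hq m i; rewrite Qm.
  move=> y ym; exists 0; have := Hq y i.
  by case: (boolP (Q i y)) => // /minm; rewrite leqNgt ym.
move=> [k [w [gw ->]]]; apply/QP.
have := gw (inord 1); rewrite /g -val_eqE /= inordK//= => ->.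
have := gw ord0; rewrite /g /= => -[+ _]; set z := tnth w ord0 => Hz; exists z.
by move: Hz => /(computes_inj (Hq z k)); rewrite (tnth_nth 0) /=; case: (Q k z).
Qed.

Import Order.TTheory GRing.Theory Num.Theory.
Import numFieldNormedType.Exports.
Local Open Scope ring_scope.

(** * Rational and computable reals *)

Lemma computable_of_nat {A} {cA : coding A} (F : A -> nat) :
  computable F -> computable (fun a => Cantor.of_nat (F a)).
Proof.
move=> [f Hf]; exists f => a; rewrite /= /enc_prod /= -surjective_pairing.
by rewrite Cantor.cancel_to_of; exact: Hf.
Qed.

Lemma computable_decode {A} {cA : coding A} (F : A -> nat) :
  computable F -> computable (fun a => CodeSeq.decode (F a)).
Proof.
move=> [f Hf]; exists f => a; rewrite /= /enc_seq /= map_id CodeSeq.decodeK; exact: Hf.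
Qed.

Lemma computable_code {A} {cA : coding A} (L : A -> seq nat) :
  computable L -> computable (fun a => CodeSeq.code (L a)).
Proof.
by move=> [f Hf]; exists f => a; have := Hf a; rewrite /= /enc_seq map_id.
Qed.

Section RationalValued.
Context {R : realType} {A : Type} {cA : coding A}.

(** The numerator is a difference of naturals and the denominator a successor, so that neither
    integers nor zero denominators have to be coded. *)
Definition rational_valued (x : A -> R) := exists p q r : A -> nat,
  [/\ computable p, computable q, computable r &
    forall a, x a = ((p a)%:R - (q a)%:R) / (r a).+1%:R].

Lemma rational_nat (n : A -> nat) : computable n -> rational_valued (fun a => (n a)%:R).
Proof.
move=> hn; exists n, (fun=> 0%N), (fun=> 0%N); split=> //; try exact: computable_const.
by move=> a; rewrite subr0 divr1.
Qed.

Lemma rational_invS (n : A -> nat) :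
  computable n -> rational_valued (fun a => (n a).+1%:R^-1).
Proof.
move=> hn; exists (fun=> 1%N), (fun=> 0%N), n; split=> //; try exact: computable_const.
by move=> a; rewrite subr0 div1r.
Qed.

Lemma rational_opp (x : A -> R) : rational_valued x -> rational_valued (fun a => - x a).
Proof.
move=> [p [q [r [hp hq hr xE]]]]; exists q, p, r; split=> // a.
by rewrite xE -mulNr opprB.
Qed.

Lemma rational_add (x y : A -> R) :
  rational_valued x -> rational_valued y -> rational_valued (fun a => x a + y a).
Proof.
move=> [p [q [r [hp hq hr xE]]]] [p' [q' [r' [hp' hq' hr' yE]]]].
(* [r + r.+1 * r'] is the predecessor of the common denominator [r.+1 * r'.+1]. *)
exists (fun a => p a * (r' a).+1 + p' a * (r a).+1)%N,
  (fun a => q a * (r' a).+1 + q' a * (r a).+1)%N, (fun a => r a + (r a).+1 * r' a)%N.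
split; try by computability.
move=> a; rewrite xE yE.
have -> : (r a + (r a).+1 * r' a).+1 = ((r a).+1 * (r' a).+1)%N by lia.
rewrite !natrD !natrM; field.
by rewrite !nat1r !pnatr_eq0.
Qed.

Lemma rational_mul (x y : A -> R) :
  rational_valued x -> rational_valued y -> rational_valued (fun a => x a * y a).
Proof.
move=> [p [q [r [hp hq hr xE]]]] [p' [q' [r' [hp' hq' hr' yE]]]].
exists (fun a => p a * p' a + q a * q' a)%N,
  (fun a => p a * q' a + q a * p' a)%N, (fun a => r a + (r a).+1 * r' a)%N.
split; try by computability.
move=> a; rewrite xE yE.
have -> : (r a + (r a).+1 * r' a).+1 = ((r a).+1 * (r' a).+1)%N by lia.
rewrite !natrD !natrM; field.
by rewrite !nat1r !pnatr_eq0.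
Qed.

Lemma rational_invP (n : A -> nat) : computable n -> (forall a, 0 < n a)%N ->
  rational_valued (fun a => (n a)%:R^-1).
Proof.
move=> hn n0; have [p [q [r [hp hq hr xE]]]] := rational_invS (computable_pred hn).
by exists p, q, r; split=> // a; rewrite -xE prednK.
Qed.

Lemma rational_posrat (j : A -> nat) :
  computable j -> rational_valued (fun a => posrat R (j a)).
Proof.
move=> hj; have hc := computable_of_nat hj.
exists (fun a => (Cantor.of_nat (j a)).1.+1), (fun=> 0%N), (fun a => (Cantor.of_nat (j a)).2).
split; try by computability.
by move=> a; rewrite /posrat subr0; case: (Cantor.of_nat _).
Qed.

Lemma rational_ratcode (k : A -> nat) :
  computable k -> rational_valued (fun a => ratcode R (k a)).
Proof.
move=> hk; have hc := computable_of_nat hk.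
have hd := computable_of_nat (computable_fst hc).
exists (fun a => (Cantor.of_nat (Cantor.of_nat (k a)).1).1),
  (fun a => (Cantor.of_nat (Cantor.of_nat (k a)).1).2), (fun a => (Cantor.of_nat (k a)).2).
split; try by computability.
by move=> a; rewrite /ratcode; case: (Cantor.of_nat (k a)) => u v /=;
  case: (Cantor.of_nat u).
Qed.

Lemma rational_exp2N (n : A -> nat) :
  computable n -> rational_valued (fun a => 2 ^- n a).
Proof.
move=> hn; have [|p [q [r [hp hq hr xE]]]] := rational_invP (computable_exp2 hn).
  by move=> a; rewrite expn_gt0.
by exists p, q, r; split=> // a; rewrite -xE natrX.
Qed.

Lemma semi_rational_lt (x y : A -> R) :
  rational_valued x -> rational_valued y -> semidecidable (fun a => x a < y a).
Proof.
move=> hx hy; have [p [q [r [hp hq hr xE]]]] := rational_add hy (rational_opp hx).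
apply: semi_ext (semi_leq (computable_succ hq) hp) => a.
by rewrite -subr_gt0 xE pmulr_lgt0 ?invr_gt0 ?ltr0Sn// subr_gt0 ltr_nat.
Qed.

Lemma semi_rational_le (x y : A -> R) :
  rational_valued x -> rational_valued y -> semidecidable (fun a => x a <= y a).
Proof.
move=> hx hy; have [p [q [r [hp hq hr xE]]]] := rational_add hy (rational_opp hx).
apply: semi_ext (semi_leq hq hp) => a.
by rewrite -subr_ge0 xE pmulr_lge0 ?invr_gt0 ?ltr0Sn// subr_ge0 ler_nat.
Qed.

End RationalValued.

Lemma rational_comp {R : realType} {A B} {cA : coding A} {cB : coding B}
    (x : B -> R) (F : A -> B) :
  rational_valued x -> computable F -> rational_valued (fun a => x (F a)).
Proof.
move=> [p [q [r [hp hq hr xE]]]] hF; exists (p \o F), (q \o F), (r \o F).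
by split=> [|||a]; [exact: computable_comp..|exact: xE].
Qed.

(** A strict inequality is witnessed by one approximation: [x < y] iff the algorithm has, at some
    precision [n], an output [k] with [ratcode k + 2 ^- n < y]; symmetrically for [y < x]. *)
Lemma semi_computable_real {R : realType} (x : nat -> nat -> R) :
  uniformly_computable2 x -> forall A (cA : coding A) (I J : A -> nat) (y : A -> R),
  computable I -> computable J -> rational_valued y ->
  semidecidable (fun a => x (I a) (J a) < y a) /\
  semidecidable (fun a => y a < x (I a) (J a)).
Proof.
move=> [phi Hphi] A cA I J y hI hJ hy.
pose S1 (a : A) (p : nat * nat) := computes phi (ntup 3 [:: I a; J a; p.1]) p.2.
have hS1 : semidecidable (fun p : A * (nat * nat) => S1 p.1 p.2).
  have hI' : computable (fun p : A * (nat * nat) => I p.1) by apply: (computable_comp hI); computability.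
  have hJ' : computable (fun p : A * (nat * nat) => J p.1) by apply: (computable_comp hJ); computability.
  by apply: (semi_comp (F := fun p : A * (nat * nat) => ([:: I p.1; J p.1; p.2.1], p.2.2))
    (semi_computes phi)); computability.
have S1P a n k : S1 a (n, k) -> `|ratcode R k - x (I a) (J a)| <= 2 ^- n.
  have [k' Hk' kx] := Hphi (I a) (J a) n.
  by rewrite /S1 -[[:: I a; J a; n]]/(val [tuple I a; J a; n]) ntupK => /(computes_inj Hk') /= <-.
have S1ex a n : exists2 k, S1 a (n, k) & `|ratcode R k - x (I a) (J a)| <= 2 ^- n.
  have [k' Hk' kx] := Hphi (I a) (J a) n; exists k' => //.
  by rewrite /S1 -[[:: I a; J a; n]]/(val [tuple I a; J a; n]) ntupK.
have small (e : R) : 0 < e -> exists n, 2 ^- n < e.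
  move=> e0; have [n _ /(_ n (leqnn n)) /= ne] := near_infty_natSinv_lt (PosNum e0).
  exists n; apply: le_lt_trans ne.
  by rewrite lef_pV2 ?posrE ?exprn_gt0 ?ltr0Sn// -natrX ler_nat ltn_expl.
have hy' : rational_valued (fun p : A * (nat * nat) => y p.1).
  by apply: (rational_comp hy); computability.
have hr : rational_valued (fun p : A * (nat * nat) => ratcode R p.2.2).
  by apply: rational_ratcode; computability.
have h2 : rational_valued (fun p : A * (nat * nat) => 2 ^- p.2.1 : R).
  by apply: rational_exp2N; computability.
split.
- apply: (semi_ext (P := fun a => exists p, S1 a p /\ ratcode R p.2 + 2 ^- p.1 < y a)).
    move=> a; split.
      by move=> [[n k] [/S1P /= H1 H2]]; move: H1; rewrite ler_norml; lra.
    (* Half of the gap, since [2 ^- n] counts twice: as the error of the approximation and as the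
       margin of the test. *)
    move=> xy;
      have [n Hn] : exists n, 2 ^- n < (y a - x (I a) (J a)) / 2 by apply: small; lra.
    have [k Hk kx] := S1ex a n; exists (n, k); split=> //=.
    by move: kx; rewrite ler_norml; lra.
  apply: (semi_exists (P := fun a p => S1 a p /\ ratcode R p.2 + 2 ^- p.1 < y a)).
  by apply: semi_and => //; apply: semi_rational_lt => //; exact: rational_add.
- apply: (semi_ext (P := fun a => exists p, S1 a p /\ y a < ratcode R p.2 - 2 ^- p.1)).
    move=> a; split.
      by move=> [[n k] [/S1P /= H1 H2]]; move: H1; rewrite ler_norml; lra.
    move=> xy;
      have [n Hn] : exists n, 2 ^- n < (x (I a) (J a) - y a) / 2 by apply: small; lra.
    have [k Hk kx] := S1ex a n; exists (n, k); split=> //=.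
    by move: kx; rewrite ler_norml; lra.
  apply: (semi_exists (P := fun a p => S1 a p /\ y a < ratcode R p.2 - 2 ^- p.1)).
  apply: semi_and => //; apply: semi_rational_lt => //.
  by apply: rational_add => //; exact: rational_opp.
Qed.

(** * Ideal balls and ideal measures *)

Section Balls.
Context {R : realType} {X : completeMetricType R} (s : nat -> X).

Definition ideal_center (b : nat) : X := s (Cantor.of_nat b).1.
Definition ideal_radius (b : nat) : R := posrat R (Cantor.of_nat b).2.

(** Shrinking the radii leaves room for a Lipschitz function between the indicators of two unions;
    the full union is recovered as [r] decreases to 0. *)
Definition shrunk_union (l : seq nat) (r : R) : set (borel X) :=
  [set x | exists2 b, b \in l & mdist (ideal_center b) x < ideal_radius b - r].

Lemma ideal_ballE b :
  ideal_ball s b = [set x | mdist (ideal_center b) x < ideal_radius b].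
Proof.
by rewrite /ideal_ball /ideal_center /ideal_radius; case: Cantor.of_nat => i j;
  rewrite ballEmdist.
Qed.

Lemma ideal_measureE n (A : set (borel X)) : ideal_measure s n A =
  ((\sum_(k < size (atoms n)) (atom_weight n k)%:R * \1_A (atom_point s n k)) /
    (total_weight n)%:R)%:E.
Proof.
rewrite /ideal_measure /= /atomic_measure /msum mulr_suml -sumEFin.
apply: eq_bigr => k _; rewrite mulrAC.
by transitivity ((atom_prob R n k)%:num%:E * (\1_A (atom_point s n k))%:E)%E.
Qed.

Lemma total_weight_gt0 n : (0 < total_weight n)%N.
Proof.
rewrite /total_weight /atoms; case: (Cantor.of_nat n) => h t /=.
by rewrite big_ord_recl.
Qed.

(** The entries of [atoms] before unpairing: unpairing after [nth] avoids having to compute a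
    [map]. *)
Definition atom_codes n := (Cantor.of_nat n).1 :: CodeSeq.decode (Cantor.of_nat n).2.

Lemma size_atoms n : size (atoms n) = size (atom_codes n).
Proof. by rewrite /atoms /atom_codes; case: Cantor.of_nat => h t; rewrite size_map. Qed.

Lemma nth_atoms n k : nth (0, 0)%N (atoms n) k = Cantor.of_nat (nth 0%N (atom_codes n) k).
Proof.
rewrite /atoms /atom_codes; case: Cantor.of_nat => h t.
case: (ltnP k (size (h :: CodeSeq.decode t))) => kt; first by rewrite (nth_map 0%N).
by rewrite !nth_default// size_map.
Qed.

Context {A : Type} {cA : coding A} (N : A -> nat) (L : A -> seq nat) (r x : A -> R).
Hypotheses (Xcms : computable_metric_space s) (hN : computable N) (hL : computable L)
  (hr : rational_valued r) (hx : rational_valued x).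

Let hcodes {B} {cB : coding B} (n : B -> nat) : computable n -> computable (fun b => atom_codes (n b)).
Proof.
move=> hn; have h := computable_of_nat hn; apply: computable_cons; first by computability.
by apply: computable_decode; computability.
Qed.

Let hweight {B} {cB : coding B} (n k : B -> nat) : computable n -> computable k ->
  computable (fun b => atom_weight (n b) (k b)).
Proof.
move=> hn hk; have h := computable_of_nat (computable_nth 0%N (hcodes hn) hk).
by apply: computable_ext (computable_succ (computable_fst h)) => b;
  rewrite /atom_weight nth_atoms.
Qed.

(** Whether an atom lies in the union is only semi-decidable, so the measure is approached from
    below. A list [c] of flags is guessed, each nonzero flag must be confirmed by some ball, and the
    flagged weight, a rational, is compared with [x]. Confirmed flags never exceed the true measure,
    and flagging all atoms of the union reaches it. *)
Lemma semi_lower_measure : semidecidable (fun a =>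
  x a < fine (ideal_measure s (N a) (shrunk_union (L a) (r a)))).
Proof.
pose S a (c : seq nat) (k : nat) := nth 0%N c k = 0%N \/
  exists2 b, b \in L a &
    mdist (ideal_center b) (s (Cantor.of_nat (nth 0%N (atom_codes (N a)) k)).2) < ideal_radius b - r a.
apply: (semi_ext (P := fun a => exists c : seq nat,
  (forall k, (k < size (atom_codes (N a)))%N -> S a c k) /\
  x a < (\sum_(k < size (atom_codes (N a)))
    (nth 0%N c k != 0%N) * atom_weight (N a) k)%N%:R / (total_weight (N a))%:R)).
  move=> a; rewrite ideal_measureE /= size_atoms; split.
    move=> [c [Hc xc]]; apply: lt_le_trans xc _.
    rewrite ler_pM2r ?invr_gt0 ?ltr0n ?total_weight_gt0//.
    rewrite natr_sum; apply: ler_sum => k _; rewrite natrM mulrC ler_wpM2l// indicE.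
    rewrite /atom_point nth_atoms; have [->|Hk] := Hc k (ltn_ord k);
      first by rewrite eqxx.
    by rewrite mem_set//; case: eqP.
  move=> xm; pose A' : set (borel X) := shrunk_union (L a) (r a).
  exists (mkseq (fun k => nat_of_bool (atom_point s (N a) k \in A')) (size (atom_codes (N a)))).
  split.
    move=> k kN; rewrite /S nth_mkseq//.
    case: (boolP (_ \in _)) => [|_]; last by left.
    by rewrite inE /A' /shrunk_union /= /atom_point nth_atoms => h; right.
  apply: lt_le_trans xm _.
  rewrite ler_pM2r ?invr_gt0 ?ltr0n ?total_weight_gt0//.
  rewrite natr_sum; apply: ler_sum => k _;
    rewrite natrM mulrC ler_wpM2r// indicE nth_mkseq//.
  by case: (_ \in _).
apply: (semi_exists (P := fun a c => (forall k, (k < size (atom_codes (N a)))%N -> S a c k) /\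
  x a < (\sum_(k < size (atom_codes (N a)))
    (nth 0%N c k != 0%N) * atom_weight (N a) k)%N%:R / (total_weight (N a))%:R)).
have hN1 : computable (fun p : A * seq nat => N p.1) by apply: (computable_comp hN);
  computability.
have hN2 : computable (fun p : (A * seq nat) * nat => N p.1.1).
  by apply: (computable_comp hN); computability.
have hc1 := hcodes hN1; have hc2 := hcodes hN2.
apply: semi_and.
- apply: (semi_forall_lt (P := fun (p : A * seq nat) k => S p.1 p.2 k));
    last by computability.
  apply: semi_or; first by apply: semi_eq; computability.
  apply: (semi_exists_mem (P := fun (p : (A * seq nat) * nat) b =>
    mdist (ideal_center b) (s (Cantor.of_nat (nth 0%N (atom_codes (N p.1.1)) p.2)).2) < ideal_radius b - r p.1.1));
    last by apply: (computable_comp hL); computability.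
  have hN3 : computable (fun p : ((A * seq nat) * nat) * nat => N p.1.1.1).
    by apply: (computable_comp hN); computability.
  have hc3 := hcodes hN3.
  have hb : computable (fun p : ((A * seq nat) * nat) * nat => Cantor.of_nat p.2).
    by apply: computable_of_nat; computability.
  have hat : computable (fun p : ((A * seq nat) * nat) * nat =>
      Cantor.of_nat (nth 0%N (atom_codes (N p.1.1.1)) p.1.2)).
    by apply: computable_of_nat; computability.
  apply: (semi_computable_real Xcms.2 (computable_fst hb) (computable_snd hat) _).1.
  apply: rational_add; first by apply: rational_posrat; computability.
  by apply: rational_opp; apply: (rational_comp hr); computability.
- apply: semi_rational_lt; first by apply: (rational_comp hx); computability.
  apply: rational_mul.
    apply: rational_nat; apply: (computable_sum (F := fun (p : A * seq nat) k =>
      (nth 0 p.2 k != 0) * atom_weight (N p.1) k)%N); last by computability.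
    apply: computable_muln; last by apply: hweight; computability.
    by apply: (dec_neg (P := fun p : (A * seq nat) * nat => nth 0%N p.1.2 p.2 == 0%N));
      apply: dec_eqn; computability.
  apply: rational_invP => [|p]; last exact: total_weight_gt0.
  apply: (computable_ext (F := fun p : A * seq nat =>
      (\sum_(k < size (atom_codes (N p.1))) atom_weight (N p.1) k)%N)).
    by move=> p; rewrite /total_weight size_atoms.
  apply: (computable_sum (F := fun (p : A * seq nat) k => atom_weight (N p.1) k));
    last by computability.
  by apply: hweight; computability.
Qed.
End Balls.

(** * Probability measures on a metric space *)

Section Probability.
Context {d} {T : measurableType d} {R : realType} (P : probability T R).

Definition pr (A : set T) : R := fine (P A).

Lemma prE A : measurable A -> P A = (pr A)%:E.
Proof. by move=> mA; rewrite fineK//; exact: fin_num_measure. Qed.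

Lemma pr_ge0 A : 0 <= pr A.
Proof. exact: fine_ge0. Qed.

Lemma le_pr A B : measurable A -> measurable B -> A `<=` B -> pr A <= pr B.
Proof. by move=> mA mB AB; rewrite -lee_fin -!prE// le_measure// inE. Qed.

Lemma pr_le1 A : measurable A -> pr A <= 1.
Proof. by move=> mA; rewrite -lee_fin -prE// probability_le1. Qed.

Lemma prC A : measurable A -> pr (~` A) = 1 - pr A.
Proof.
move=> mA; apply: EFin_inj; rewrite -prE ?probability_setC ?prE//.
exact: measurableC.
Qed.

(** Continuity from below along the unions over the indices of [I] smaller than [n]. It carries
    estimates from finite unions of balls, the only ones that can be tested, to arbitrary unions. *)
Lemma pr_bigcup_le (F : nat -> set T) (I : set nat) (c : R) :
  (forall i, measurable (F i)) ->
  (forall l : seq nat, (forall i, i \in l -> I i) -> pr (\bigcup_(i in [set` l]) F i) <= c) ->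
  pr (\bigcup_(i in I) F i) <= c.
Proof.
move=> mF Hc; pose G n := \bigcup_(i in [set i | I i /\ (i < n)%N]) F i.
have mG n : measurable (G n) by exact: bigcup_measurable.
have UG : \bigcup_(i in I) F i = \bigcup_n G n.
  apply/seteqP; split=> x [i].
    by move=> Ii Fx; exists i.+1 => //; exists i => //=; split.
  by move=> _ [j [Ij _] Fx]; exists j.
have ndG : nondecreasing_seq G.
  move=> m n mn; apply/subsetPset => x [i [Ii im] Fx]; exists i => //; split=> //.
  exact: leq_trans im mn.
have mU : measurable (\bigcup_n G n) by exact: bigcupT_measurable.
have := nondecreasing_cvg_mu (mu := P) mG mU ndG.
rewrite UG -lee_fin -prE// => /cvg_lim <-//; apply: lime_le.
  by apply: ereal_nondecreasing_is_cvgn => m n mn; apply: le_measure; rewrite ?inE//;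
    exact/subsetPset/ndG.
apply: nearW => n /=; rewrite prE// lee_fin.
have -> : G n = \bigcup_(i in [set` [seq i <- iota 0 n | `[< I i >]]]) F i.
  apply/seteqP; split=> x [i /= Hi Fx]; exists i => //=.
    by rewrite mem_filter mem_iota asboolT//; case: Hi.
  by move: Hi; rewrite mem_filter mem_iota => /andP[/asboolP].
by apply: Hc => i; rewrite mem_filter => /andP[/asboolP].
Qed.

End Probability.

Section Metric.
Context {R : realType} {X : completeMetricType R}.

Lemma open_borel (A : set X) : open A -> measurable (A : set (borel X)).
Proof. by move=> oA; exact: sub_sigma_algebra. Qed.

Lemma lipschitz1_open_gt (f : X -> R) c : lipschitz1 f -> open [set x | c < f x].
Proof.
move=> lf; rewrite openE => x /= cfx; apply/nbhs_ballP.
exists (f x - c) => /=; first by rewrite subr_gt0.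
move=> y; rewrite ballEmdist /= => xy.
by have := lf x y; rewrite ler_norml; lra.
Qed.

Lemma lipschitz1_measurable (f : X -> R) : lipschitz1 f ->
  measurable_fun setT (f : borel X -> R).
Proof.
move=> lf; apply: (measurability _ (RGenOInfty.measurableE R)) => _ [_ [c ->] <-].
rewrite setTI; apply: open_borel.
suff -> : f @^-1` `]c, +oo[ = [set x | c < f x] by exact: lipschitz1_open_gt.
by apply/seteqP; split=> x /=; rewrite in_itv /= andbT.
Qed.

Lemma lipschitz1_dist (x : X) : lipschitz1 (mdist x).
Proof.
move=> y z; have := metric_triangle x y z; have := metric_triangle x z y.
by rewrite [mdist z y]metric_sym ler_norml; lra.
Qed.

End Metric.

Lemma dist_max_le {R : realType} (a b c d e : R) :
  `|a - c| <= e -> `|b - d| <= e -> `|Num.max a b - Num.max c d| <= e.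
Proof.
by rewrite !maxEle; case: (leP a b) => ab; case: (leP c d) => cd; rewrite !ler_norml; lra.
Qed.

Lemma dist_min_le {R : realType} (a b c d e : R) :
  `|a - c| <= e -> `|b - d| <= e -> `|Num.min a b - Num.min c d| <= e.
Proof.
by rewrite !minEle; case: (leP a b) => ab; case: (leP c d) => cd; rewrite !ler_norml; lra.
Qed.

Section Depth.
Context {R : realType} {X : completeMetricType R} (s : nat -> X).

(** A 1-Lipschitz function whose superlevel sets are the shrunk unions. The maximum starts from 0,
    which restricts this to levels [r >= 0]. *)
Definition depth (l : seq nat) (x : X) : R :=
  \big[Num.max/0]_(b <- l) (ideal_radius b - mdist (ideal_center s b) x).

Lemma depth_lipschitz1 l : lipschitz1 (depth l).
Proof.
move=> x y; rewrite /depth; elim: l => [|b l IHl].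
  by rewrite !big_nil subrr normr0 mdist_ge0.
rewrite !big_cons; apply: dist_max_le IHl.
by have := lipschitz1_dist (ideal_center s b) x y; rewrite !ler_norml; lra.
Qed.

Lemma shrunk_unionE l r : 0 <= r -> shrunk_union s l r = [set x | r < depth l x].
Proof.
move=> r0; apply/seteqP; split=> x /=; rewrite /depth.
  elim: l => [|c l IHl] [b]; first by rewrite in_nil.
  rewrite inE big_cons lt_max => /orP[/eqP->|bl] Hb; first by apply/orP; left; lra.
  by apply/orP; right; apply: IHl; exists b.
elim: l => [|b l IHl]; first by rewrite big_nil ltNge r0.
rewrite big_cons lt_max => /orP[rb|/IHl[c cl Hc]].
  by exists b; rewrite ?mem_head//; move: rb; lra.
by exists c; rewrite // inE cl orbT.
Qed.

Lemma shrunk_union_open l r : 0 <= r -> open (shrunk_union s l r : set X).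
Proof. by move=> r0; rewrite shrunk_unionE//; apply: lipschitz1_open_gt;
  exact: depth_lipschitz1. Qed.

Lemma shrunk_union0 l : shrunk_union s l (0 : R) = \bigcup_(b in [set` l]) ideal_ball s b.
Proof.
apply/seteqP; split=> x [b bl Hb]; exists b => //.
  by rewrite ideal_ballE /=; move: Hb; rewrite subr0.
by move: Hb; rewrite ideal_ballE /= subr0.
Qed.

Lemma shrunk_union_measurable l (r : R) :
  0 <= r -> measurable (shrunk_union s l r : set (borel X)).
Proof. by move=> r0; apply: open_borel; exact: shrunk_union_open. Qed.
End Depth.

Section Wasserstein.
Context {R : realType} {X : completeMetricType R} (Xbounded : bounded_space X).
Implicit Types (mu nu : PM X) (f : X -> R).

Lemma lipschitz1_integrable mu f : lipschitz1 f ->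
  (mu : {measure set (borel X) -> \bar R}).-integrable setT (EFin \o f).
Proof.
move=> lf; apply: measurable_bounded_integrable => //.
- apply: le_lt_trans (probability_le1 (mu : probability _ _) _) _ => //; exact: ltry.
- exact: lipschitz1_measurable.
have [M HM] := Xbounded; exists (`|f point| + M); split; first exact: num_real.
move=> y My x _ /=; apply: le_trans (ltW My).
have := lf x point; have := HM x point.
have := ler_normD (f x - f point) (f point); rewrite subrK; lra.
Qed.

Lemma W1_lipschitz1 mu nu f e : lipschitz1 f -> (W1 mu nu < e%:E)%E ->
  `|\int[mu]_x f x - \int[nu]_x f x| < e.
Proof.
move=> lf; rewrite -lte_fin; apply: le_lt_trans.
by apply: ereal_sup_ubound; exists f.
Qed.

Lemma integrable_cindic mu (A : set (borel X)) c : measurable A ->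
  (mu : {measure set (borel X) -> \bar R}).-integrable setT (EFin \o (fun x => c * \1_A x)).
Proof.
move=> mA; rewrite (_ : _ \o _ = fun x => (c%:E * (EFin \o \1_A) x)%E)//.
apply: integrableZl => //.
by apply: integrable_indic => //; rewrite setIT fin_num_fun_lty.
Qed.

Lemma Rintegral_indic mu (A : set (borel X)) c : measurable A ->
  \int[mu]_x (c * \1_A x) = c * pr mu A.
Proof.
move=> mA; rewrite RintegralZl//; first by rewrite /Rintegral integral_indic// setIT.
by apply: integrable_indic => //; rewrite setIT fin_num_measure// fin_num_fun_lty.
Qed.

(* Compare the integrals of [min (max (depth l - r) 0) eta], which lies between
   [eta] times the indicators of the two shrunk unions. *)
Lemma W1_shrunk_union (s : nat -> X) mu nu l r eta e : 0 <= r -> 0 < eta ->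
  (W1 mu nu < e%:E)%E ->
  pr mu (shrunk_union s l (r + eta)) <= pr nu (shrunk_union s l r) + e / eta.
Proof.
move=> r0 eta0 We.
pose f (x : X) := Num.min (Num.max (depth s l x - r) 0) eta.
have lf : lipschitz1 f.
  move=> x y; apply: dist_min_le; last by rewrite subrr normr0 mdist_ge0.
  apply: dist_max_le; last by rewrite subrr normr0 mdist_ge0.
  by have := depth_lipschitz1 s l x y; rewrite !ler_norml; lra.
have mS t : 0 <= t -> measurable (shrunk_union s l t : set (borel X)).
  exact: shrunk_union_measurable.
have re0 : 0 <= r + eta by lra.
have f0 x : 0 <= f x by rewrite le_min le_max lexx orbT ltW.
have fe x : f x <= eta by rewrite ge_min lexx orbT.
have lo : eta * pr mu (shrunk_union s l (r + eta)) <= \int[mu]_x f x.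
  rewrite -Rintegral_indic; last exact: mS.
  apply: le_Rintegral => //;
    [apply: integrable_cindic; exact: mS|exact: (lipschitz1_integrable mu lf)|].
  move=> x _; rewrite indicE shrunk_unionE//; case: (boolP (_ \in _)) => [|_].
    by rewrite inE /= mulr1 => re; rewrite le_min lexx le_max lerBrDl ltW.
  by rewrite mulr0.
have hi : \int[nu]_x f x <= eta * pr nu (shrunk_union s l r).
  rewrite -Rintegral_indic; last exact: mS.
  apply: le_Rintegral => //;
    [exact: (lipschitz1_integrable nu lf)|apply: integrable_cindic; exact: mS|].
  move=> x _; rewrite indicE shrunk_unionE//; case: (boolP (_ \in _)) => [_|].
    by rewrite mulr1.
  rewrite notin_setE /= => /negP; rewrite -leNgt mulr0 => dr.
  by rewrite ge_min ge_max lexx subr_le0 dr.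
have /ltr_normlW dfe := @W1_lipschitz1 mu nu f e lf We.
clear f0 fe; have etaN0 : eta != 0 by rewrite gt_eqF.
rewrite -(ler_pM2l eta0) mulrDr [eta * (e / eta)]mulrC divfK//; lra.
Qed.

(** Isolation yields equality on Borel sets only, while ideal balls are defined through [W1]; this
    lemma connects the two. *)
Lemma PM_eq_W1 mu nu : PM_eq mu nu -> W1 mu nu = 0%E.
Proof.
move=> mn; apply/eqP; rewrite eq_le; apply/andP; split.
  apply: ge_ereal_sup => _ [f lf <-]; rewrite /Rintegral.
  rewrite (eq_measure_integral (nu : {measure set (borel X) -> \bar R})); last first.
    by move=> A mA _; exact: mn.
  by rewrite subrr normr0.
apply: ereal_sup_ubound; exists (fun=> 0);
  last by rewrite /Rintegral !integral0 /= subrr normr0.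
by move=> x y; rewrite subrr normr0 mdist_ge0.
Qed.
End Wasserstein.

(** * A criterion for invariance *)

Lemma posrat_gt0 {R : realType} j : 0 < posrat R j.
Proof. by rewrite /posrat; case: Cantor.of_nat => a b; rewrite divr_gt0. Qed.

Lemma posrat_dense {R : realType} (x y : R) : 0 <= x -> x < y ->
  exists j, x < posrat R j < y.
Proof.
move=> x0 xy; have d0 : 0 < y - x by rewrite subr_gt0.
have [b _ /(_ b (leqnn b)) /= Hb] := near_infty_natSinv_lt (PosNum d0).
have B0 : 0 < b.+1%:R :> R by [].
(* The numerator is the least integer above [x * b.+1]; [b] was chosen so that a step of length
   [1 / b.+1] fits between [x] and [y]. *)
have [n nP] : exists n : nat, x * b.+1%:R < n.+1%:R <= x * b.+1%:R + 1.
  exists (Num.truncn (x * b.+1%:R)); have /andP[] := truncn_itv (mulr_ge0 x0 (ltW B0)).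
  by rewrite -[(Num.truncn _).+1%:R]natr1; lra.
exists (Cantor.to_nat (n, b)); rewrite /posrat Cantor.cancel_of_to.
have /andP[h1 h2] := nP; rewrite ltr_pdivlMr// h1/= ltr_pdivrMr//.
apply: le_lt_trans h2 _; rewrite -ltrBrDl -mulrBl.
by rewrite -ltr_pdivrMr// div1r.
Qed.

Section Separation.
Context {R : realType} {X : completeMetricType R} (s : nat -> X) (sdense : dense (range s)).

Definition ball_union (l : seq nat) : set (borel X) := \bigcup_(b in [set` l]) ideal_ball s b.

(** Stated on centres and radii to be semi-decidable; the strict inequality keeps the balls at
    positive distance. *)
Definition formally_disjoint (l l' : seq nat) := forall b, b \in l -> forall b', b' \in l' ->
  ideal_radius b + ideal_radius b' < mdist (ideal_center s b) (ideal_center s b') :> R.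

Lemma mdist_ball_open (x : X) r : open [set y | mdist x y < r].
Proof.
have -> : [set y | mdist x y < r] = [set y | - r < - mdist x y].
  by apply/seteqP; split=> y /=; rewrite ltrN2.
apply: lipschitz1_open_gt => y z; rewrite -opprD normrN; exact: lipschitz1_dist.
Qed.

Lemma ideal_ball_open b : open (ideal_ball s b).
Proof. by rewrite ideal_ballE; exact: mdist_ball_open. Qed.

Lemma ideal_ball_measurable b : measurable (ideal_ball s b : set (borel X)).
Proof. by apply: open_borel; exact: ideal_ball_open. Qed.

Lemma ball_union_measurable (I : set nat) :
  measurable (\bigcup_(b in I) ideal_ball s b : set (borel X)).
Proof. by apply: bigcup_measurable => b _; exact: ideal_ball_measurable. Qed.

Lemma small_ideal_ball x (e : R) : 0 < e ->
  exists b, ideal_radius b < e /\ ideal_ball s b x.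
Proof.
move=> e0; have [j /andP[j0 je]] := posrat_dense (lexx 0) e0.
have [|y [xi [i _ iy]]] := sdense _ (mdist_ball_open x (posrat R j)).
  by exists x; rewrite /= mdistxx.
exists (Cantor.to_nat (i, j)); rewrite ideal_ballE /ideal_radius /ideal_center.
by rewrite !Cantor.cancel_of_to /= metric_sym iy.
Qed.

Definition outside (l : seq nat) : set (borel X) :=
  \bigcup_(b in [set b | formally_disjoint l [:: b]]) ideal_ball s b.

(** A point outside finitely many closed balls keeps a margin [e] from all of them, and an ideal
    ball of radius below [e / 2] around it is formally disjoint from [l]. Points on a bounding
    sphere have no margin, hence the closed balls in the conclusion. *)
Lemma outsideP l x :
  ~ outside l x -> exists2 b, b \in l & mdist (ideal_center s b) x <= ideal_radius b.
Proof.
move=> xl; apply: contrapT => xl'; apply: xl.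
have [e e0 He] : exists2 e : R, 0 < e &
    forall b, b \in l -> ideal_radius b + e <= mdist (ideal_center s b) x.
  elim: l xl' => [|b l IHl] xl; first by exists 1.
  have [|e e0 He] := IHl; first by move=> [c cl Hc]; apply: xl; exists c;
    rewrite // inE cl orbT.
  have xb : ideal_radius b < mdist (ideal_center s b) x.
    by rewrite ltNge; apply/negP => Hb; apply: xl; exists b; rewrite ?mem_head.
  exists (Num.min e (mdist (ideal_center s b) x - ideal_radius b)).
    by rewrite lt_min e0 subr_gt0.
  move=> c; rewrite inE => /orP[/eqP->|/He cx].
    by rewrite -lerBrDl ge_min lexx orbT.
  by apply: le_trans cx; rewrite lerD2l ge_min lexx.
have [b [be bx]] := small_ideal_ball x (divr_gt0 e0 (ltr0Sn R 1)).
exists b => //= c /He cx b'; rewrite inE => /eqP ->.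
move: bx; rewrite ideal_ballE /=.
have := metric_triangle (ideal_center s c) (ideal_center s b) x; lra.
Qed.

Section MeasureLe.
Variables mu1 mu2 : probability (borel X) R.
Hypothesis mu12 : forall l l', formally_disjoint l l' ->
  pr mu1 (ball_union l) + pr mu2 (ball_union l') <= 1.

(* [mu12] bounds [mu1] of a union of balls by [mu2] of the union of the
   corresponding closed balls. *)
Lemma pr_open_le (O : set X) : open O -> pr mu1 O <= pr mu2 O.
Proof.
move=> oO;
  (* Closed balls have to lie in [O], since these are what [outsideP] returns; the corresponding
     open balls still exhaust [O]. *)
  pose I := [set b | [set x | mdist (ideal_center s b) x <= ideal_radius b] `<=` O].
have mO : measurable (O : set (borel X)) by exact: open_borel.
have -> : pr mu1 O = pr mu1 (\bigcup_(b in I) ideal_ball s b).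
  congr (pr mu1 _); apply/seteqP; split=> x.
    move=> Ox; move: (oO); rewrite openE => /(_ x Ox) /= /nbhs_ballP[e /= e0 xeO].
    have [b [be bx]] := small_ideal_ball x (divr_gt0 e0 (ltr0Sn R 1)).
    exists b => // y /= by_; apply: xeO; rewrite ballEmdist /=.
    move: bx; rewrite ideal_ballE /= => bx.
    have := metric_triangle x (ideal_center s b) y.
    by rewrite (metric_sym x (ideal_center s b)); lra.
  by move=> [b bI]; rewrite ideal_ballE /= => bx; apply: bI => /=; exact: ltW.
apply: pr_bigcup_le => [b|l lI]; first exact: ideal_ball_measurable.
(* [mu12] speaks of finite lists; the bound passes to the whole of [outside l], whose complement is
   contained in [O]. *)
have out1 : pr mu2 (outside l) <= 1 - pr mu1 (ball_union l).
  apply: pr_bigcup_le => [b|l' l'out]; first exact: ideal_ball_measurable.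
  rewrite lerBrDl; apply: mu12 => b bl b' b'l'.
  by have := l'out _ b'l'; apply => //; rewrite inE.
have mout : measurable (outside l) by exact: ball_union_measurable.
have : pr mu2 (~` outside l) <= pr mu2 O.
  apply: le_pr => //; first exact: measurableC.
  by move=> x /outsideP[b bl bx]; exact: (lI b bl).
by rewrite prC// -/(ball_union l); lra.
Qed.
End MeasureLe.

Lemma pr_open_eq (mu1 mu2 : probability (borel X) R) :
  (forall O : set X, open O -> pr mu1 O = pr mu2 O) ->
  forall A : set (borel X), measurable A -> mu1 A = mu2 A.
Proof.
move=> mu12; apply: (@measure_unique _ R (borel X) (@open X) (fun=> setT)) => //.
- by move=> A B; exact: openI.
- by move=> _; exact: openT.
- by rewrite bigcup_const//; exists 0%N.
- move=> A oA; transitivity (pr mu1 A)%:E; first exact: (prE mu1 (open_borel oA)).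
  by rewrite mu12//; apply/esym; exact: (prE mu2 (open_borel oA)).
- by move=> _; apply: le_lt_trans (probability_le1 mu1 _) _ => //; exact: ltry.
Qed.

Variables (T : X -> X) (Tmeas : measurable_fun [set: borel X] (T : borel X -> borel X)).

(** Forward, the two unions are disjoint. Backward, the condition compares [mu] with its image under
    [T]; formal disjointness being symmetric, [pr_open_le] applies in both directions, so both
    measures agree on open sets, hence on Borel sets. *)
Lemma invariantP (mu : PM X) : invariant_measure T mu <->
  forall l l', formally_disjoint l l' ->
    pr mu (ball_union l) + pr mu (T @^-1` ball_union l') <= 1.
Proof.
have mT (A : set (borel X)) : measurable A -> measurable (T @^-1` A : set (borel X)).
  by move=> mA; rewrite -[_ @^-1` _]setTI; exact: Tmeas.
split=> [inv l l' ll'|H].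
  rewrite {2}/pr -inv; last exact: ball_union_measurable.
  have disj : ball_union l' `<=` ~` ball_union l.
    move=> x [b' b'l' b'x] [b bl bx]; have := ll' _ bl _ b'l'.
    move: bx b'x; rewrite !ideal_ballE /=.
    have := metric_triangle (ideal_center s b) x (ideal_center s b').
    by rewrite (metric_sym x (ideal_center s b')); lra.
  have := le_pr mu (ball_union_measurable _) (measurableC (ball_union_measurable _)) disj.
  by rewrite prC ?/pr; [lra|exact: ball_union_measurable].
pose T' : {mfun borel X >-> borel X} := HB.pack (T : borel X -> borel X) (isMeasurableFun.Build _ _ _ _ _ Tmeas).
move=> A mA; apply: (@pr_open_eq mu (distribution mu T')) => // O oO.
apply/eqP; rewrite eq_le; apply/andP; split; apply: pr_open_le => // l l' ll'.
rewrite addrC; apply: (H l' l) => b bl' b' b'l; rewrite addrC metric_sym; exact: ll'.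
Qed.

End Separation.

(** * Semi-decidable lower bounds for the measure of an open set *)

(* [compact_cover] is stated for pointed spaces. *)
HB.instance Definition _ (R : realType) (X : completeMetricType R) :=
  isPointed.Build (PM X) (ideal_measure (fun=> point : X) 0%N).

Section Certificates.
Context {R : realType} {X : completeMetricType R} (s : nat -> X) (Xbounded : bounded_space X).
Implicit Types (mu nu : PM X) (l : seq nat) (b : nat) (q : R).

Definition measure_center b : PM X := ideal_measure s (Cantor.of_nat b).1.

Lemma ideal_measure_ballE b :
  ideal_ball (ideal_measure s) b = [set nu | (W1 (measure_center b) nu < (ideal_radius b)%:E)%E].
Proof. by rewrite /ideal_ball /measure_center /ideal_radius; case: Cantor.of_nat. Qed.

(* By [W1_shrunk_union], [certified b l q] entails [q < nu (ball_union l)] for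
   every [nu] in the ideal ball [b]. *)
Definition certified b l q := exists e,
  q + ideal_radius b / posrat R e < pr (measure_center b) (shrunk_union s l (posrat R e)).

Lemma certified_lt b l q nu :
  certified b l q -> ideal_ball (ideal_measure s) b nu -> q < pr nu (ball_union s l).
Proof.
move=> [e He]; rewrite ideal_measure_ballE /= => Wb.
have := W1_shrunk_union Xbounded s l (lexx 0) (posrat_gt0 e) Wb.
by rewrite add0r shrunk_union0 -/(ball_union s l); lra.
Qed.

(** By continuity from below, [nu] already exceeds [q] on the union shrunk by [2 * eta] for some
    [eta]. Passing from [nu] to the centre of the ball costs one [eta] of shrinking and
    [radius / eta] of mass; the certificate spends the other [eta] and [radius / eta] once more.
    Hence [d] is half the gap times [eta]. *)
Lemma lt_certified l q nu : q < pr nu (ball_union s l) ->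
  exists2 d : R, 0 < d & forall b, ideal_radius b < d ->
    ideal_ball (ideal_measure s) b nu -> certified b l q.
Proof.
move=> qnu; pose F n := shrunk_union s l (posrat R (Cantor.to_nat (0%N, n)) *+ 2).
have mF n : measurable (F n).
  by apply: shrunk_union_measurable; rewrite mulrn_wge0// ltW// posrat_gt0.
have FE n : posrat R (Cantor.to_nat (0%N, n)) = n.+1%:R^-1.
  by rewrite /posrat Cantor.cancel_of_to div1r.
have F_mono : {homo F : m n / (m <= n)%N >-> m `<=` n}.
  move=> m n mn x [b bl bx]; exists b => //; apply: lt_le_trans bx _.
  by rewrite lerB// lerMn2r/= !FE lef_pV2 ?posrE// ler_nat.
have [n Hn] : exists n, q < pr nu (F n).
  apply: contrapT => Hq; move: qnu; apply/negP; rewrite -leNgt.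
  have -> : ball_union s l = \bigcup_(n in setT) F n.
    rewrite /ball_union -shrunk_union0; apply/seteqP; split=> x.
      move=> [b bl bx].
      have d0 : 0 < ideal_radius b - mdist (ideal_center s b) x by move: bx;
        rewrite subr0 subr_gt0.
      have [n _ /(_ n (leqnn n)) /= Hn] := near_infty_natSinv_lt (PosNum (divr_gt0 d0 (ltr0Sn R 1))).
      exists n => //; exists b => //; rewrite FE mulr2n.
      by move: (n.+1%:R^-1) Hn => u Hn; clear -Hn; lra.
    move=> [n _ [b bl bx]]; exists b => //; apply: lt_le_trans bx _.
    by rewrite lerB// mulrn_wge0// ltW// posrat_gt0.
  apply: pr_bigcup_le => // L _.
  pose N := (\max_(i <- L) i)%N.
  apply: (@le_trans _ _ (pr nu (F N))).
    apply: le_pr => //; first by apply: bigcup_measurable => k _.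
    by move=> x [k /= kL]; apply: F_mono; exact: leq_bigmax_seq.
  by rewrite leNgt; apply/negP => ?; apply: Hq; exists N.
pose e := Cantor.to_nat (0%N, n); set eta := posrat R e.
have eta0 : 0 < eta by exact: posrat_gt0.
exists ((pr nu (F n) - q) * eta / 2); first by rewrite divr_gt0// mulr_gt0// subr_gt0.
move=> b bd; rewrite ideal_measure_ballE /= W1_sym => Wb; exists e; rewrite -/eta.
have := W1_shrunk_union Xbounded s l (ltW eta0) eta0 Wb.
rewrite -mulr2n -[shrunk_union s l (eta *+ 2)]/(F n).
have : ideal_radius b / eta < (pr nu (F n) - q) / 2 by rewrite ltr_pdivrMr// mulrAC.
lra.
Qed.

Lemma W1_ball_open mu (e : R) : open [set nu | (W1 mu nu < e%:E)%E].
Proof.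
rewrite openE => nu /= We; apply/nbhs_ballP.
have W0 : (0 <= W1 mu nu)%E.
  apply: ereal_sup_ubound; exists (fun=> 0);
    last by rewrite /Rintegral !integral0 /= subrr normr0.
  by move=> x y; rewrite subrr normr0 mdist_ge0.
have Wfin : W1 mu nu \is a fin_num.
  by rewrite ge0_fin_numE//; apply: lt_trans We _; exact: ltry.
exists (e - fine (W1 mu nu)) => /=; first by rewrite subr_gt0 -lte_fin fineK.
move=> rho /= Wrho; apply: le_lt_trans (W1_triangle mu nu rho) _.
by rewrite -(fineK Wfin) -lteBrDl// -EFinB.
Qed.

Lemma compact_ideal_balls (V O : set (PM X)) (S : set nat) : compact V -> open O ->
  V `<=` O `|` \bigcup_(b in S) ideal_ball (ideal_measure s) b ->
  exists2 l : seq nat, (forall b, b \in l -> S b) &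
    V `<=` O `|` \bigcup_(b in [set` l]) ideal_ball (ideal_measure s) b.
Proof.
rewrite (@compact_cover (PM X)) => cV oO VOS.
(* The open set [O] joins the family of balls as the index [None]. *)
pose F (o : option nat) := if o is Some b then ideal_ball (ideal_measure s) b else O.
pose D := [set o : option nat | if o is Some b then S b else True].
have [[b|] _||D' D'D VD'] := cV _ D F.
- by rewrite /F ideal_measure_ballE; exact: W1_ball_open.
- by [].
- by move=> mu /VOS[Omu|[b Sb bmu]]; [exists None|exists (Some b)].
exists (pmap id D') => [b|mu /VD'[[b|] bD' Fb]].
- by rewrite mem_pmap map_id => /D'D; rewrite inE.
- by right; exists b => //=; rewrite mem_pmap map_id.
- by left.
Qed.

End Certificates.

(** * Density of the ideal measures *)

(** The head is coded apart from the tail, which accounts for [iota 1 N]. The resulting weights are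
    [w i + 1], by the definition of [atom_weight]. *)
Lemma ideal_measure_index (w : nat -> nat) N : exists n,
  atoms n = [seq (w i, i) | i <- iota 0 N.+1].
Proof.
exists (Cantor.to_nat (Cantor.to_nat (w 0, 0),
  CodeSeq.code [seq Cantor.to_nat (w i, i) | i <- iota 1 N]))%N.
rewrite /atoms Cantor.cancel_of_to CodeSeq.codeK /= Cantor.cancel_of_to; congr (_ :: _).
by rewrite -map_comp; apply: eq_map => i; rewrite /= Cantor.cancel_of_to.
Qed.

(** [w i] is [p i * Q] rounded up, and [W] is the sum of these weights. In [w i / W - p i = ((w i -
    p i * Q) + p i * (Q - W)) / W], rounding contributes at most 1 per term and normalization at
    most [|Q - W| <= Q * delta + N] in total, while [W >= Q / 2] because the [p i] sum to more than
    1/2. The bound is [(2 * N + Q * delta) / (Q / 2)]. *)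
Lemma normalized_weights_close {R : realType} N (p : nat -> R) (w : nat -> nat) (Q delta : R) :
  0 < Q -> delta <= 2^-1 -> (forall i, 0 <= p i) ->
  (forall i, p i * Q <= (w i)%:R <= p i * Q + 1) ->
  1 - delta < \sum_(i < N) p i <= 1 ->
  \sum_(i < N) `|(w i)%:R / (\sum_(j < N) w j)%N%:R - p i| <= 4 * N%:R / Q + 2 * delta.
Proof.
move=> Q0 delta2 p0 wp; set P := \sum_(i < N) p i => /andP[P1 P2].
set W : R := (\sum_(j < N) w j)%N%:R.
have W1 : P * Q <= W.
  by rewrite /W natr_sum mulr_suml; apply: ler_sum => i _; have /andP[] := wp i.
have W2 : W <= P * Q + N%:R.
  rewrite /W natr_sum mulr_suml;
    have -> : N%:R = \sum_(i < N) 1 :> R by rewrite sumr_const card_ord.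
  by rewrite -big_split; apply: ler_sum => i _; have /andP[] := wp i.
have P0 : 2^-1 < P by lra.
have Q2 : Q / 2 <= P * Q by rewrite mulrC ler_pM2r// ltW.
have W0 : 0 < W by lra.
have N0 : 0 <= N%:R :> R by [].
have QW : `|Q - W| <= Q * delta + N%:R.
  have h1 : (1 - P) * Q <= Q * delta by rewrite mulrC ler_pM2l//; lra.
  have h2 : P * Q <= Q by rewrite ler_piMl// ltW.
  have h3 : 0 <= Q * delta by rewrite mulr_ge0//; lra.
  rewrite ler_norml; lra.
apply: (@le_trans _ _ (\sum_(i < N) (1 + p i * `|Q - W|) / W)).
  apply: ler_sum => i _; have /andP[w1 w2] := wp i.
  have -> : (w i)%:R / W - p i = (((w i)%:R - p i * Q) + p i * (Q - W)) / W.
    by field; rewrite gt_eqF.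
  rewrite normrM normfV (gtr0_norm W0) ler_pM2r ?invr_gt0//.
  apply: le_trans (ler_normD _ _) _; rewrite normrM (ger0_norm (p0 i)) lerD2r.
  by rewrite ger0_norm; lra.
rewrite -mulr_suml big_split/= sumr_const card_ord -mulr_suml -/P ler_pdivrMr//.
have -> : 4 * N%:R / Q + 2 * delta = (4 * N%:R + 2 * (Q * delta)) / Q.
  by field; rewrite gt_eqF.
rewrite mulrAC ler_pdivlMr//.
have h4 : P * `|Q - W| <= Q * delta + N%:R.
  by apply: le_trans QW; rewrite ler_piMl.
have h5 : (N%:R + P * `|Q - W|) * Q <= (2 * N%:R + Q * delta) * Q.
  by rewrite ler_pM2r//; lra.
apply: le_trans h5 _.
have -> : (2 * N%:R + Q * delta) * Q = (4 * N%:R + 2 * (Q * delta)) * (Q / 2) by field.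
by apply: ler_wpM2l; [have : 0 <= Q * delta by rewrite mulr_ge0//; lra|]; lra.
Qed.

Section Density.
Context {R : realType} {X : completeMetricType R} (s : nat -> X).
Hypotheses (sdense : dense (range s)) (Xbounded : bounded_space X).

Lemma integral_ideal_measure n (g : X -> R) : lipschitz1 g -> (forall x, 0 <= g x) ->
  \int[ideal_measure s n]_x g x =
  \sum_(k < size (atoms n)) (atom_weight n k)%:R / (total_weight n)%:R * g (atom_point s n k).
Proof.
move=> lg g0; have mg : measurable_fun setT (EFin \o (g : borel X -> R)).
  by apply/measurable_EFinP; exact: lipschitz1_measurable.
rewrite /Rintegral; transitivity (fine (\sum_(k < size (atoms n))
  \int[mscale (atom_prob R n k) (\d_(atom_point s n k))]_x (g x)%:E)%E).
  congr fine; apply: (@ge0_integral_measure_sum _ _ _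
    (fun k => mscale (atom_prob R n k) (\d_(atom_point s n k)))) => //.
  by move=> x _; rewrite lee_fin.
transitivity (fine (\sum_(k < size (atoms n))
  ((atom_weight n k)%:R / (total_weight n)%:R * g (atom_point s n k))%:E)); last by rewrite sumEFin.
congr fine; apply: eq_bigr => k _.
rewrite ge0_integral_mscale//; last by move=> x _; rewrite lee_fin.
by rewrite integral_dirac// diracT mul1e EFinM.
Qed.

Section Approximation.
Variables (mu : PM X) (delta : R).
Hypothesis delta0 : 0 < delta.

(** Cells of a partition of [X]: by density every point has a first ideal point within [delta].
    Moving the mass of cell [i] to [s i] displaces it by less than [delta]. *)
Definition first_near (i : nat) : set (borel X) :=
  [set x | mdist (s i) x < delta /\ forall j, (j < i)%N -> delta <= mdist (s j) x].

Lemma first_near_measurable i : measurable (first_near i).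
Proof.
have -> : first_near i = [set x | mdist (s i) x < delta] `\`
    \bigcup_(j in [set j | (j < i)%N]) [set x | mdist (s j) x < delta].
  apply/seteqP; split=> x [xi Hx]; split=> //.
    by move=> [j /= /Hx ji]; rewrite ltNge ji.
  by move=> j ji; rewrite leNgt; apply/negP => xj; apply: Hx; exists j.
apply: measurableD; first by apply: open_borel; exact: mdist_ball_open.
by apply: bigcup_measurable => j _; apply: open_borel; exact: mdist_ball_open.
Qed.

Lemma sum_first_near N (c : nat -> R) x :
  (exists2 i, (i < N)%N & first_near i x /\ \sum_(j < N) c j * \1_(first_near j) x = c i) \/
  (forall i, (i < N)%N -> delta <= mdist (s i) x) /\ \sum_(j < N) c j * \1_(first_near j) x = 0.
Proof.
have [ex|nex] := pselect (exists i, (i < N)%N && (mdist (s i) x < delta)); last first.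
  right; have far i : (i < N)%N -> delta <= mdist (s i) x.
    by move=> iN; rewrite leNgt; apply/negP => xi; apply: nex; exists i; rewrite iN.
  split=> //; apply: big1 => j _; rewrite indicE memNset ?mulr0// => -[+ _].
  by rewrite ltNge far.
left; case: (ex_minnP ex) => i /andP[iN xi] mini; exists i => //.
have fi : first_near i x.
  split=> // j ji; rewrite leNgt; apply/negP => xj.
  by have := mini j; rewrite (ltn_trans ji iN) xj leqNgt ji => /(_ isT).
split=> //; rewrite (bigD1 (Ordinal iN))//= indicE mem_set// mulr1 big1 ?addr0// => j ji.
rewrite indicE memNset ?mulr0// => -[xj Hj].
have [/Hj|ij] := ltnP i j; first by rewrite leNgt xi.
have {}ij : (j < i)%N by rewrite ltn_neqAle ij andbT.
by case: fi => _ /(_ _ ij); rewrite leNgt xj.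
Qed.

Lemma integrable_first_near N (c : nat -> R) (k : R) :
  (mu : {measure set (borel X) -> \bar R}).-integrable setT
    (EFin \o (fun x => \sum_(j < N) c j * \1_(first_near j) x + k)) /\
  \int[mu]_x (\sum_(j < N) c j * \1_(first_near j) x + k) =
    \sum_(j < N) c j * pr mu (first_near j) + k.
Proof.
have mT : (mu setT < +oo)%E.
  by apply: le_lt_trans (probability_le1 (mu : probability _ _) _) _ => //; exact: ltry.
elim: N => [|N [IH1 IH2]].
  split.
    rewrite (_ : _ \o _ = EFin \o cst k); last by apply/funext => x /=;
      rewrite big_ord0 add0r.
    exact: finite_measure_integrable_cst.
  under eq_Rintegral do rewrite big_ord0 add0r.
  rewrite Rintegral_cst// big_ord0 add0r -/(pr mu setT).
  have -> : pr mu setT = 1 by rewrite /pr probability_setT.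
  by rewrite mulr1.
have iI : (mu : {measure set (borel X) -> \bar R}).-integrable setT
    (EFin \o (fun x => c N * \1_(first_near N) x)).
  by apply: integrable_cindic; exact: first_near_measurable.
have E : (fun x => \sum_(j < N.+1) c j * \1_(first_near j) x + k) =
    (fun x => c N * \1_(first_near N) x + (\sum_(j < N) c j * \1_(first_near j) x + k)).
  by apply/funext => x; rewrite big_ord_recr /= addrAC addrC.
rewrite E; split; first exact: (@integrableD _ _ _ _ _ _ (EFin \o _) (EFin \o _)).
rewrite RintegralD// IH2 Rintegral_indic; last exact: first_near_measurable.
by rewrite big_ord_recr /= addrAC [LHS]addrC.
Qed.

(** The cells exhaust [X], so finitely many carry mass above [1 - delta] by continuity from below.
    Writing partial sums as integrals of step functions reduces the estimates to pointwise ones. *)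
Lemma first_near_tail : exists N, 1 - delta < \sum_(j < N) pr mu (first_near j) <= 1.
Proof.
have mfn := first_near_measurable.
have sumE N : \sum_(j < N) pr mu (first_near j) = \int[mu]_x (\sum_(j < N) 1 * \1_(first_near j) x + 0).
  by rewrite (integrable_first_near N (fun=> 1) 0).2 addr0; apply: eq_bigr => j _;
    rewrite mul1r.
have le1 N : \sum_(j < N) pr mu (first_near j) <= 1.
  rewrite sumE; have [i1 _] := integrable_first_near N (fun=> 1) 0.
  have [i0 i0E] := integrable_first_near 0 (fun=> 0) 1.
  apply: le_trans (_ : \int[mu]_x (\sum_(j < 0) 0 * \1_(first_near j) x + 1) <= _).
    apply: le_Rintegral => // x _; rewrite addr0 big_ord0 add0r.
    by have [[i _ [_ ->]]|[_ ->]] := sum_first_near N (fun=> 1) x.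
  by rewrite i0E big_ord0 add0r.
apply: contrapT => HN.
have {}HN N : \sum_(j < N) pr mu (first_near j) <= 1 - delta.
  by rewrite leNgt; apply/negP => h; apply: HN; exists N; rewrite h le1.
have : pr mu (\bigcup_(i in setT) first_near i) <= 1 - delta.
  apply: pr_bigcup_le => // L _; pose N := (\max_(i <- L) i).+1.
  apply: le_trans (HN N); rewrite sumE.
  have [i1 _] := integrable_first_near N (fun=> 1) 0.
  have mU : measurable (\bigcup_(i in [set` L]) first_near i) by apply: bigcup_measurable.
  rewrite -[leLHS]mul1r -Rintegral_indic//; apply: le_Rintegral => //.
    exact: integrable_cindic.
  move=> x _; rewrite mul1r addr0 indicE.
  have [[i _ [_ ->]]|[far ->]] := sum_first_near N (fun=> 1) x; first by case: (_ \in _).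
  rewrite memNset//= => -[i /= iL [xi _]].
  by have := far i; rewrite ltnS leq_bigmax_seq// leNgt xi => /(_ isT).
have -> : \bigcup_(i in setT) first_near i = setT.
  apply/seteqP; split=> // x _.
  have [|y [xy [i _ iy]]] := sdense _ (mdist_ball_open x delta).
    by exists x; rewrite /= mdistxx.
  have ex : exists i, mdist (s i) x < delta by exists i; rewrite metric_sym iy.
  case: (ex_minnP ex) => j xj minj; exists j => //; split=> // k kj.
  by rewrite leNgt; apply/negP => /minj; rewrite leqNgt kj.
have -> : pr mu setT = 1 by rewrite /pr probability_setT.
by rewrite lerBrDr gerDl leNgt delta0.
Qed.
End Approximation.

Lemma Rintegral_addr (mu : PM X) f c : lipschitz1 f ->
  \int[mu]_x (f x + c) = \int[mu]_x f x + c.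
Proof.
move=> lf; rewrite RintegralD//; last 2 first.
- exact: lipschitz1_integrable.
- exact: finite_measure_integrable_cst.
congr (_ + _); transitivity (c * fine (mu setT)); last by rewrite probability_setT mulr1.
exact: (Rintegral_cst (mu : probability _ _)).
Qed.

Lemma ideal_measure_dense (mu : PM X) e : 0 < e ->
  exists n, (W1 (ideal_measure s n) mu < e%:E)%E.
Proof.
move=> e0; have [M HM] := Xbounded; pose C := 2 * (`|M| + 1).
have C0 : 0 < C by rewrite mulr_gt0// ltr_wpDl.
(* With [N] cells, the final error is [4 * C * N / Q] from rounding plus [(1 + 3 * C) * delta]:
   [2 * C * delta] from normalization, [delta] from the size of the cells, [C * delta] from the
   neglected tail. Here and in the choice of [Q], each of the two parts is given [e / 4];
   [normalized_weights_close] asks for [delta <= 1/2]. *)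
pose delta := Num.min 2^-1 (e / (4 * (1 + 3 * C))).
have d0 : 0 < delta by rewrite lt_min invr_gt0 ltr0Sn/= divr_gt0//; lra.
have d2 : delta <= 2^-1 by rewrite ge_min lexx.
have de : (1 + 3 * C) * delta <= e / 4.
  have : delta <= e / (4 * (1 + 3 * C)) by rewrite ge_min lexx orbT.
  by rewrite ler_pdivlMr; lra.
have [N HP] := first_near_tail mu d0.
pose p j := pr mu (first_near delta j).
case: N => [|N] in HP *; first by move: HP; rewrite big_ord0; lra.
pose Q : R := (Num.truncn (16 * C * N.+1%:R / e)).+1%:R.
have Q0 : 0 < Q by [].
have QN : 16 * C * N.+1%:R <= e * Q.
  have h0 : 0 <= 16 * C * N.+1%:R / e by rewrite divr_ge0 ?mulr_ge0// ltW.
  by rewrite [e * Q]mulrC -ler_pdivrMr// ltW//; have /andP[] := truncn_itv h0.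
(* Truncation is right because [atom_weight] adds one, so the actual weights round [p i * Q]
   upwards. *)
pose w i := Num.truncn (p i * Q).
have p0 i : 0 <= p i by exact: pr_ge0.
have wp i : p i * Q <= (w i).+1%:R <= p i * Q + 1.
  have /andP[] := truncn_itv (mulr_ge0 (p0 i) (ltW Q0)).
  by rewrite -/(w i) -[(w i).+1%:R]natr1; lra.
have [n nE] := ideal_measure_index w N.
have szn : size (atoms n) = N.+1 by rewrite nE size_map size_iota.
have nthn k : (k < N.+1)%N -> nth (0, 0)%N (atoms n) k = (w k, k).
  by move=> kN; rewrite nE (nth_map 0%N) ?size_iota// nth_iota.
have WE : total_weight n = (\sum_(j < N.+1) (w j).+1)%N.
  rewrite /total_weight szn; apply: eq_bigr => j _.
  by rewrite /atom_weight nthn.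
have close := normalized_weights_close (w := fun i => (w i).+1) Q0 d2 p0 wp HP.
(* A supremum of quantities below [e] need not be below [e], hence the target [e / 2] for each test
   function. *)
exists n; apply: (@le_lt_trans _ _ (e / 2)%:E); last first.
  by rewrite lte_fin; lra.
apply: ge_ereal_sup => _ [f lf <-]; rewrite lee_fin.
(* Both measures have mass 1, so adding a constant to [f] does not change the difference of
   integrals; the shifted function takes its values between 0 and [C]. *)
pose c := `|M| + 1 - f (s 0%N); pose g x := f x + c.
have lg : lipschitz1 g by move=> x y; rewrite /g opprD addrACA subrr addr0; exact: lf.
have gb x : 0 <= g x <= C.
  have := lf x (s 0%N); have := HM x (s 0%N); have := ler_norm M; have := normr_ge0 M.
  by rewrite /g /c /C ler_norml; lra.
have -> : \int[ideal_measure s n]_x f x - \int[mu]_x f x =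
    \int[ideal_measure s n]_x g x - \int[mu]_x g x.
  by rewrite !Rintegral_addr// opprD addrACA subrr addr0.
rewrite integral_ideal_measure//; last by move=> x; have /andP[] := gb x.
rewrite szn; set I1 := \sum_(k < _) _.
pose I0 := \sum_(k < N.+1) p k * g (s k).
have I10 : `|I1 - I0| <= C * (4 * N.+1%:R / Q + 2 * delta).
  rewrite /I1 /I0 -sumrB; apply: le_trans (ler_norm_sum _ _ _) _.
  apply: le_trans (ler_wpM2l (ltW C0) close); rewrite mulr_sumr; apply: ler_sum => k _.
  rewrite /atom_weight /atom_point nthn//= WE -mulrBl normrM mulrC.
  apply: ler_wpM2r => //; have /andP[g0 gC] := gb (s k).
  by rewrite ger0_norm.
have lo : I0 - delta <= \int[mu]_x g x.
  have [i1 E1] := integrable_first_near mu delta N.+1 (fun k => g (s k)) (- delta).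
  rewrite /I0; under eq_bigr do rewrite mulrC; rewrite -E1.
  apply: le_Rintegral => //; first exact: lipschitz1_integrable.
  move=> x _;
    have [[i _ [[xi _] ->]]|[_ ->]] := sum_first_near delta N.+1 (fun k => g (s k)) x.
    by have := lg (s i) x; rewrite ler_norml; lra.
  by have /andP[] := gb x; lra.
(* The upper step function is [g (s k) + delta] on cell [k] and [C + delta] off the cells, where the
   mass is less than [delta]. *)
have hi : \int[mu]_x g x <= I0 + delta + C * delta.
  have [i1 E1] := integrable_first_near mu delta N.+1 (fun k => g (s k) - C) (delta + C).
  apply: (@le_trans _ _ (\sum_(k < N.+1) (g (s k) - C) * p k + (delta + C))).
    rewrite -E1; apply: le_Rintegral => //; first exact: lipschitz1_integrable.
    move=> x _;
      have [[i _ [[xi _] ->]]|[_ ->]] := sum_first_near delta N.+1 (fun k => g (s k) - C) x.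
      by have := lg (s i) x; rewrite ler_norml; lra.
    by have /andP[] := gb x; lra.
  under eq_bigr do rewrite mulrBl; rewrite sumrB -mulr_sumr.
  have -> : \sum_(k < N.+1) g (s k) * p k = I0 by apply: eq_bigr => k _; rewrite mulrC.
  have : C * (1 - delta) <= C * \sum_(k < N.+1) p k.
    by rewrite ler_pM2l//; case/andP: HP => /ltW.
  lra.
have CN : C * (4 * N.+1%:R / Q) <= e / 4 by rewrite mulrA ler_pdivrMr//; lra.
have Cd : 0 <= C * delta by rewrite mulr_ge0// ltW.
have {}de : delta + 3 * (C * delta) <= e / 4 by rewrite mulrA -{1}[delta]mul1r -mulrDl.
move: I10; rewrite mulrDr [C * (2 * delta)]mulrCA.
move: (C * (4 * N.+1%:R / Q)) (C * delta) CN Cd lo hi de => u v CN Cd lo hi de.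
rewrite !ler_norml; clear -CN Cd lo hi de; lra.
Qed.
End Density.

(** * The complement of the invariant measures is recursively open *)

(** [D] may fail to be measurable; the comparison goes through a measurable null set containing
    it. *)
Lemma pr_eq_ae d (T : measurableType d) (R : realType) (P : probability T R)
    (A B D : set T) : measurable A -> measurable B -> P.-negligible D ->
  A `&` ~` D = B `&` ~` D -> pr P A = pr P B.
Proof.
have half (A' B' : set T) : measurable A' -> measurable B' -> P.-negligible D ->
    A' `&` ~` D = B' `&` ~` D -> pr P A' <= pr P B'.
  move=> mA mB [N [mN N0 DN]] AB; rewrite -lee_fin -!prE//.
  apply: (@le_trans _ _ (P (B' `|` N))); last first.
    apply: le_trans (measureU2 _ _ _) _ => //; rewrite -[leRHS]adde0.
    have PN0 : (P N <= 0)%E by rewrite N0.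
    exact: leeD.
  apply: le_measure; rewrite ?inE//; first exact: measurableU.
  move=> x Ax; have [Dx|Dx] := pselect (D x); first by right; exact: DN.
  by left; have [] : (B' `&` ~` D) x by rewrite -AB.
by move=> mA mB nD AB; apply/eqP; rewrite eq_le !half.
Qed.

Section Noninvariance.
Variables (R : realType) (X : completeMetricType R) (s : nat -> X).
Hypotheses (Xcms : computable_metric_space s) (Xbounded : bounded_space X).
Variables (T : X -> X) (D : set X) (E : nat -> set nat).
Hypotheses (Tmeas : measurable_fun [set: borel X] (T : borel X -> borel X))
  (E_re : uniformly_re E)
  (TE : forall n, T @^-1` ideal_ball s n `&` ~` D =
    (\bigcup_(k in E n) ideal_ball s k) `&` ~` D).

(** [l''] collects balls enumerated for the preimages of the balls of [l'], so off [D] its union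
    lies in the preimage of theirs. The last inequality need not be strict, as certificates give
    strict bounds. *)
Definition noninvariance_witness (b : nat)
    (w : ((seq nat * seq nat) * seq nat) * (nat * nat)) :=
  let: (l, l', l'', (q, q')) := w in
  [/\ formally_disjoint s l l', forall c, c \in l'' -> exists2 n, n \in l' & E n c,
    certified s b l (posrat R q), certified s b l'' (posrat R q') &
    1 <= posrat R q + posrat R q'].

Lemma semi_formally_disjoint :
  semidecidable (fun p : seq nat * seq nat => formally_disjoint s p.1 p.2).
Proof.
apply: (semi_forall_mem (P := fun (p : seq nat * seq nat) b => forall b', b' \in p.2 ->
  ideal_radius b + ideal_radius b' < mdist (ideal_center s b) (ideal_center s b') :> R));
  last by computability.
apply: (semi_forall_mem (P := fun (p : (seq nat * seq nat) * nat) b' =>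
  ideal_radius p.2 + ideal_radius b' < mdist (ideal_center s p.2) (ideal_center s b') :> R));
  last by computability.
have h1 : computable (fun p : ((seq nat * seq nat) * nat) * nat => Cantor.of_nat p.1.2).
  by apply: computable_of_nat; computability.
have h2 : computable (fun p : ((seq nat * seq nat) * nat) * nat => Cantor.of_nat p.2).
  by apply: computable_of_nat; computability.
apply: (semi_computable_real Xcms.2 (computable_fst h1) (computable_fst h2) _).2.
by apply: rational_add; apply: rational_posrat; computability.
Qed.

Lemma semi_certified :
  semidecidable (fun p : (nat * seq nat) * nat => certified s p.1.1 p.1.2 (posrat R p.2)).
Proof.
have h1 : computable (fun p : ((nat * seq nat) * nat) * nat => Cantor.of_nat p.1.1.1).
  by apply: computable_of_nat; computability.
have h2 : computable (fun p : ((nat * seq nat) * nat) * nat => Cantor.of_nat p.2).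
  by apply: computable_of_nat; computability.
(* The inverse of [posrat R p.2], obtained by exchanging numerator and denominator. *)
pose x (p : ((nat * seq nat) * nat) * nat) : R := (Cantor.of_nat p.2).2.+1%:R / (Cantor.of_nat p.2).1.+1%:R.
have hx : rational_valued x.
  apply: rational_mul; first by apply: rational_nat; computability.
  by apply: rational_invS; computability.
apply: (semi_exists (P := fun (p : (nat * seq nat) * nat) e =>
  posrat R p.2 + ideal_radius p.1.1 / posrat R e <
  pr (measure_center s p.1.1) (shrunk_union s p.1.2 (posrat R e)))).
apply: (semi_lower_measure Xcms); [by computability|by computability| |].
  by apply: rational_posrat; computability.
apply: rational_add; first by apply: rational_posrat; computability.
apply: rational_mul; first by apply: rational_posrat; computability.
move: hx => [p [q [r [hp hq hr xE]]]]; exists p, q, r; split=> // a;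
  rewrite -xE /x /posrat.
by case: Cantor.of_nat => u v /=; rewrite invf_div.
Qed.

Lemma semi_noninvariance_witness :
  semidecidable (fun b => exists w, noninvariance_witness b w).
Proof.
apply: (semi_exists (P := noninvariance_witness)).
pose W : Type := (nat * (((seq nat * seq nat) * seq nat) * (nat * nat)))%type.
apply: (semi_ext (P := fun p : W =>
  formally_disjoint s p.2.1.1.1 p.2.1.1.2 /\
  ((forall c, c \in p.2.1.2 -> exists2 n, n \in p.2.1.1.2 & E n c) /\
  (certified s p.1 p.2.1.1.1 (posrat R p.2.2.1) /\
  (certified s p.1 p.2.1.2 (posrat R p.2.2.2) /\
  1 <= posrat R p.2.2.1 + posrat R p.2.2.2))))).
  by move=> [b [[[l l'] l''] [q q']]] /=; split=> [[? [? [? []]]]|[]].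
apply: semi_and;
  first by apply: (semi_comp (F := fun p : W => p.2.1.1) semi_formally_disjoint);
    computability.
apply: semi_and.
  apply: (semi_forall_mem (P := fun (p : W) c => exists2 n, n \in p.2.1.1.2 & E n c));
    last by computability.
  apply: (semi_exists_mem (P := fun (p : W * nat) n => E n p.2)); last by computability.
  by apply: (semi_comp (F := fun p : (W * nat) * nat => (p.2, p.1.2)) (uniformly_re_semi E_re));
    computability.
apply: semi_and.
  by apply: (semi_comp (F := fun p : W => ((p.1, p.2.1.1.1), p.2.2.1)) semi_certified);
    computability.
apply: semi_and.
  by apply: (semi_comp (F := fun p : W => ((p.1, p.2.1.2), p.2.2.2)) semi_certified);
    computability.
apply: semi_rational_le; first exact: (rational_nat (computable_const 1%N)).
by apply: rational_add; apply: rational_posrat; computability.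
Qed.

Let preimage_measurable (A : set (borel X)) : measurable A -> measurable (T @^-1` A : set (borel X)).
Proof. by move=> mA; rewrite -[_ @^-1` _]setTI; exact: Tmeas. Qed.

Variable nu : PM X.
Hypothesis nuD : nu.-negligible (D : set (borel X)).

(** Replaces the preimage, which is not controlled on [D], by a union of enumerated balls; nothing
    is lost since [D] is [nu]-null. *)
Let pr_preimage l :
  pr nu (T @^-1` ball_union s l) =
  pr nu (\bigcup_(k in [set k | exists2 n, n \in l & E n k]) ideal_ball s k).
Proof.
apply: (pr_eq_ae (D := (D : set (borel X)))) => //.
- by apply: preimage_measurable; exact: ball_union_measurable.
- exact: ball_union_measurable.
apply/seteqP; split=> x [].
  move=> [n nl nx] Dx;
    have [[k kE kx] _] : ((\bigcup_(k in E n) ideal_ball s k) `&` ~` D) x.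
    by rewrite -TE.
  by split=> //; exists k => //; exists n.
move=> [k [n nl kE] kx] Dx; have [nx _] : (T @^-1` ideal_ball s n `&` ~` D) x.
  by rewrite TE; split=> //; exists k.
by split=> //; exists n.
Qed.

Lemma witness_noninvariant b w : noninvariance_witness b w ->
  ideal_ball (ideal_measure s) b nu -> ~ invariant_measure T nu.
Proof.
case: w => [[[l l'] l''] [q q']] [sep l''E c1 c2 qq] bnu /(invariantP Xcms.1 Tmeas)/(_ _ _ sep).
have := certified_lt Xbounded c1 bnu; have := certified_lt Xbounded c2 bnu.
have : pr nu (ball_union s l'') <= pr nu (T @^-1` ball_union s l').
  rewrite pr_preimage; apply: le_pr; [exact: ball_union_measurable..|].
  by move=> x [c /= cl cx]; exists c => //; exact: l''E.
lra.
Qed.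

Lemma noninvariant_witness : ~ invariant_measure T nu ->
  exists2 b, ideal_ball (ideal_measure s) b nu & exists w, noninvariance_witness b w.
Proof.
move=> ninv.
have [l [l' [sep Hll]]] : exists l l', formally_disjoint s l l' /\
    1 < pr nu (ball_union s l) + pr nu (T @^-1` ball_union s l').
  apply: contrapT => H; apply: ninv; apply/(invariantP Xcms.1 Tmeas) => l l' ll'.
  by rewrite leNgt; apply/negP => ?; apply: H; exists l, l'.
have [l'' [l''E Hl'']] : exists l'', (forall c, c \in l'' -> exists2 n, n \in l' & E n c) /\
    1 < pr nu (ball_union s l) + pr nu (ball_union s l'').
  apply: contrapT => H; move: Hll; apply/negP; rewrite -leNgt -lerBrDl pr_preimage.
  apply: pr_bigcup_le => [k|L HL]; first exact: ideal_ball_measurable.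
  by rewrite lerBrDl leNgt; apply/negP => ?; apply: H; exists L.
have le1 L : pr nu (ball_union s L) <= 1 by apply: pr_le1; exact: ball_union_measurable.
(* Taking [q] above [1 - nu (ball_union s l'')] leaves room for a [q'] with [q + q' > 1]. *)
have [q /andP[q1 q2]] : exists q, 1 - pr nu (ball_union s l'') < posrat R q < pr nu (ball_union s l).
  by apply: posrat_dense; [rewrite subr_ge0|lra].
have [q' /andP[q3 q4]] : exists q', 1 - posrat R q < posrat R q' < pr nu (ball_union s l'').
  by apply: posrat_dense; [have := le1 l; lra|lra].
have [d1 d10 c1] := lt_certified Xbounded q2;
  have [d2 d20 c2] := lt_certified Xbounded q4.
(* One ball must carry both certificates, so its radius lies below both thresholds; density then
   provides its centre. *)
have [j /andP[j0 jd]] : exists j, 0 < posrat R j < Num.min d1 d2.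
  by apply: posrat_dense => //; rewrite lt_min d10.
have [i Wi] := ideal_measure_dense Xcms.1 Xbounded nu j0.
have bnu : ideal_ball (ideal_measure s) (Cantor.to_nat (i, j)) nu.
  by rewrite ideal_measure_ballE /measure_center /ideal_radius Cantor.cancel_of_to.
have /andP[jd1 jd2] : (ideal_radius (Cantor.to_nat (i, j)) < d1) && (ideal_radius (Cantor.to_nat (i, j)) < d2).
  by rewrite -lt_min /ideal_radius Cantor.cancel_of_to.
exists (Cantor.to_nat (i, j)) => //; exists (l, l', l'', (q, q')).
by split=> //; [exact: c1|exact: c2|lra].
Qed.
End Noninvariance.

(** * The search for a finite cover *)

Lemma computable_code_cons (l0 : seq nat) :
  computable (fun p : nat * seq nat => CodeSeq.code (p.1 :: l0 ++ p.2)).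
Proof.
apply: computable_code; apply: computable_cons; first by computability.
(* [l0] is a fixed list, written into the program entry by entry and never computed. *)
by elim: l0 => [|a l0 IH] /=; computability.
Qed.

Theorem theoremA (R : realType) (X : completeMetricType R) (s : nat -> X)
    (Xcms : computable_metric_space s) (Xbounded : bounded_space X)
    (D : set X) (T : X -> X)
    (Tmeas : measurable_fun [set: borel X] (T : borel X -> borel X))
    (Tcomp : computable_on s s (~` D) T)
    (V : set (PM X)) (Vcompact : recursively_compact (ideal_measure s) V)
    (VD : forall mu : PM X, V mu -> mu.-negligible (D : set (borel X)))
    (mu : PM X) (mu_isolated : isolated_invariant T V mu) :
  computable_point (ideal_measure s) mu.
Proof.
have [U [E E_re UE] TU] := Tcomp.
have TE n : T @^-1` ideal_ball s n `&` ~` D = (\bigcup_(k in E n) ideal_ball s k) `&` ~` D.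
  by rewrite TU UE.
have [cV [f Hf]] := Vcompact; have [Vmu inv_mu [N Nmu isoN]] := mu_isolated.
have [r r0 rN] : exists2 r : R, 0 < r & [set nu | (W1 mu nu < r%:E)%E] `<=` N.
  by move: Nmu => /nbhs_ballP[r r0 rN]; exists r.
pose pball b := ideal_ball (ideal_measure s) b.
have [l0 l0mu Vl0] : exists2 l0 : seq nat, (forall b, b \in l0 -> ~ pball b mu) &
    V `<=` [set nu | (W1 mu nu < r%:E)%E] `|` \bigcup_(b in [set` l0]) pball b.
  apply: compact_ideal_balls => //; first exact: W1_ball_open.
  move=> nu _; have [?|far] := pselect (W1 mu nu < r%:E)%E; [by left|right].
  (* A ball of radius below [r / 2] containing both [nu] and [mu] would bring them within [r] of
     each other. *)
  have [j /andP[j0 jr]] : exists j, 0 < posrat R j < r / 2.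
    by apply: posrat_dense => //; exact: divr_gt0.
  have [i Wi] := ideal_measure_dense Xcms.1 Xbounded nu j0.
  have bE rho : pball (Cantor.to_nat (i, j)) rho = (W1 (ideal_measure s i) rho < (posrat R j)%:E)%E.
    by rewrite /pball ideal_measure_ballE /measure_center /ideal_radius Cantor.cancel_of_to.
  exists (Cantor.to_nat (i, j)); last by rewrite -/(pball _) bE.
  move=> /=; rewrite bE => Wmu; apply: far;
    apply: le_lt_trans (W1_triangle _ (ideal_measure s i) _) _.
  have -> : r%:E = ((r / 2)%:E + (r / 2)%:E)%E by rewrite -EFinD -splitr.
  by apply: lteD; [rewrite W1_sym|]; [apply: lt_trans Wmu _|apply: lt_trans Wi _];
    rewrite lte_fin.
pose good b := exists w, noninvariance_witness s E b w.
suff -> : computable_point (ideal_measure s) mu = recursively_enumerable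
    [set k | exists L : seq nat, halts f [tuple CodeSeq.code (k :: l0 ++ L)] /\
      forall b, b \in L -> good b].
  apply: semi_re; apply: (semi_exists (P := fun k (L : seq nat) =>
    halts f [tuple CodeSeq.code (k :: l0 ++ L)] /\ forall b, b \in L -> good b)).
  apply: semi_and; first exact/semi_halts/computable_code_cons.
  apply: (semi_forall_mem (P := fun (p : nat * seq nat) b => good b));
    last by computability.
  apply: (semi_comp (F := fun p : (nat * seq nat) * nat => p.2)); last by computability.
  exact: semi_noninvariance_witness.
congr recursively_enumerable; apply/seteqP; split=> k /=.
  move=> kmu.
  (* The open set absorbs [B_k] and the fixed balls, so that compactness selects only the list [L]
     of good balls. *)
  have [||L Lgood VL] := compact_ideal_balls (S := good) (s := s) (V := V)
      (O := pball k `|` \bigcup_(b in [set` l0]) pball b) cV.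
  - have oball b : open (pball b) by rewrite /pball ideal_measure_ballE;
    exact: W1_ball_open.
    by apply: openU => //; apply: bigcup_open.
  - move=> nu Vnu; have [inv|ninv] := pselect (invariant_measure T nu); last first.
      right; have [b bnu gb] := noninvariant_witness Xcms Xbounded Tmeas TE (VD _ Vnu) ninv.
      by exists b.
    left; have [/rN Nnu|] := Vl0 _ Vnu; last by right.
    left; have numu := isoN _ Nnu Vnu inv.
    move: kmu; rewrite /pball !ideal_measure_ballE /= => kmu.
    apply: le_lt_trans (W1_triangle _ mu _) _.
    by rewrite (W1_sym mu) (PM_eq_W1 numu) adde0.
  exists L; split=> //; apply/(Hf (k :: l0 ++ L)) => nu /VL[[knu|[b bl bnu]]|[b bL bnu]].
  - by exists k; rewrite //= mem_head.
  - by exists b; rewrite //= inE mem_cat bl orbT.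
  - by exists b; rewrite //= inE mem_cat bL !orbT.
move=> [L [/(Hf (k :: l0 ++ L)) VL Lgood]]; have [b /=] := VL _ Vmu.
rewrite inE mem_cat => /orP[/eqP-> //|/orP[/l0mu //|/Lgood[w gw] bmu]].
by have := witness_noninvariant Xcms Xbounded Tmeas TE (VD _ Vmu) gw bmu.
Qed.
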